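(* Let $0.5208<\sigma_0<0.9723$ and $10^3\le H<H_0$, where $H_0=3.061\cdot10^{10}$. Then for all $T\ge H_0$, \[ \frac{1}{T-H}\int_H^T|\zeta(\sigma_0+it)|^2\,dt\le \zeta(2\sigma_0)+\mathcal{E}_1(\sigma_0,H), \] and \[ \int_H^T\log|\zeta(\sigma_0+it)|\,dt\le\frac{T-H}{2}\log\big(\zeta(2\sigma_0)+\mathcal{E}_1(\sigma_0,H)\big). \]
   Context: $\zeta$ is the Riemann zeta function. Constants: $H_0=3.061\cdot10^{10}$, $c_0=2.1946$. Define \[ \epsilon_1(\sigma_0,H)=\frac{4H_0}{H_0-H}\Big(\frac{(\log H_0)H_0^{1-2\sigma_0}}{2(1-\sigma_0)}-\frac{(2\sigma_0-1)\log H_0}{2(1-\sigma_0)H_0}+\frac{\max\big(0,\frac{1-3\sigma_0+3\sigma_0^2}{2(1-\sigma_0)^2}-\frac{\zeta(2\sigma_0)}{2}\big)}{H_0}+\frac{(2-\sigma_0)H_0^{1-2\sigma_0}}{2(1-\sigma_0)^2}-\frac{\sigma_0H_0^{-\sigma_0}}{(1-\sigma_0)^2}+\frac{H_0^{-2\sigma_0}}{2(2\sigma_0-1)}+\frac{H_0^{-2\sigma_0-1}}{2}\Big), \] \[ \epsilon_2(\sigma_0,H)=\frac{c_0^2}{2\sigma_0-1}\cdot\frac{H^{-(2\sigma_0-1)}-H_0^{-(2\sigma_0-1)}}{H_0-H},\qquad \epsilon_3(\sigma_0,H)=2\sqrt{\epsilon_2(\sigma_0,H)\big(\zeta(2\sigma_0)+\epsilon_1(\sigma_0,H)\big)},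 \] and $\mathcal{E}_1(\sigma_0,H)=\epsilon_1(\sigma_0,H)+\epsilon_2(\sigma_0,H)+\epsilon_3(\sigma_0,H)$. *)

(* Defs.v *)
From Stdlib Require Import Reals Lra.
Open Scope R_scope.

(* Complex numbers are represented by pairs (real part, imaginary part). *)

(* k-th term (n = k+1) of the Dirichlet eta series
   eta(s) = sum_{n>=1} (-1)^(n-1) n^(-s),  s = sigma + i t,
   with n^(-s) = n^(-sigma) (cos(t log n) - i sin(t log n)). *)
Definition eta_term_re (sigma t : R) (k : nat) : R :=
  (-1) ^ k * Rpower (INR (S k)) (- sigma) * cos (t * ln (INR (S k))).
Definition eta_term_im (sigma t : R) (k : nat) : R :=
  (-1) ^ k * Rpower (INR (S k)) (- sigma) * (- sin (t * ln (INR (S k)))).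

(* is_zeta sigma t zr zi : zr + i zi = zeta(sigma + i t), via the analytic
   continuation zeta(s) = eta(s) / (1 - 2^(1-s)), valid for Re s > 0, s <> 1.
   The division is written as the product identity
   (zr + i zi) * (1 - 2^(1-s)) = eta(s), where
   2^(1-s) = 2^(1-sigma) (cos(t log 2) - i sin(t log 2)). *)
Definition is_zeta (sigma t zr zi : R) : Prop :=
  exists er ei : R,
    Un_cv (fun N => sum_f_R0 (eta_term_re sigma t) N) er /\
    Un_cv (fun N => sum_f_R0 (eta_term_im sigma t) N) ei /\
    let dr := 1 - Rpower 2 (1 - sigma) * cos (t * ln 2) in
    let di := Rpower 2 (1 - sigma) * sin (t * ln 2) in
    zr * dr - zi * di = er /\ zr * di + zi * dr = ei.

Definition H0 : R := 30610000000.
Definition c0 : R := 21946 / 10000.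

(* zeta2 stands for zeta(2 sigma0). *)
Definition eps1 (zeta2 sigma0 H : R) : R :=
  4 * H0 / (H0 - H) *
  ( ln H0 * Rpower H0 (1 - 2 * sigma0) / (2 * (1 - sigma0))
    - (2 * sigma0 - 1) * ln H0 / (2 * (1 - sigma0) * H0)
    + Rmax 0 ((1 - 3 * sigma0 + 3 * sigma0 ^ 2) / (2 * (1 - sigma0) ^ 2) - zeta2 / 2) / H0
    + (2 - sigma0) * Rpower H0 (1 - 2 * sigma0) / (2 * (1 - sigma0) ^ 2)
    - sigma0 * Rpower H0 (- sigma0) / (1 - sigma0) ^ 2
    + Rpower H0 (- 2 * sigma0) / (2 * (2 * sigma0 - 1))
    + Rpower H0 (- 2 * sigma0 - 1) / 2 ).

Definition eps2 (sigma0 H : R) : R :=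
  c0 ^ 2 / (2 * sigma0 - 1) *
  ((Rpower H (- (2 * sigma0 - 1)) - Rpower H0 (- (2 * sigma0 - 1))) / (H0 - H)).

Definition eps3 (zeta2 sigma0 H : R) : R :=
  2 * sqrt (eps2 sigma0 H * (zeta2 + eps1 zeta2 sigma0 H)).

Definition calE1 (zeta2 sigma0 H : R) : R :=
  eps1 zeta2 sigma0 H + eps2 sigma0 H + eps3 zeta2 sigma0 H.

(* Main.v *)
From Stdlib Require Import Reals Lra Lia Psatz.
From Coquelicot Require Import Coquelicot.
Require Import Defs.
Open Scope R_scope.

(* Write z = sigma + it, N = floor t. The sum of n^-z over n > N is nearly geometric with
   ratio e^(-i phi), phi ~ t/N ~ 1, so zeta(z) - sum_(n <= N) n^-z is close to
   N^(1-z)/(z-1) + N^-z w with w = 1/(e^(i phi) - 1) - 1/(i phi). The real part of w is -1/2 and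
   its imaginary part is monotone in phi, so the error committed at each step from n-1 to n is
   dominated by a telescoping quantity; this yields |zeta(z) - sum_(n <= t) n^-z| <= c0 t^-sigma.
   Squaring the partial sum and integrating term by term, the diagonal contributes at most
   (T-H) zeta(2 sigma) and the rest at most 4 sum_(m<n<=T) (mn)^-sigma / log(n/m); the bound
   1/log(n/m) <= 1 + m/(n-m) turns the latter into 4T times the bracket of eps1 at T, which
   decreases for T >= H0 because log H0 >= 24. The logarithmic bound is Jensen's inequality in
   the form log x <= log c + x/c - 1. *)

(** [is_zeta] offers only the conditionally convergent eta series. So the corrected partial sums are
    shown to converge to some Z, and Z is identified by doubling: an even eta partial sum is D(2m) -
    2^(1-z) D(m), D being the Dirichlet partial sums, and in this combination N^(1-z)/(z-1) cancels
    exactly. Cutting at N = floor t puts phi near 1, where Im w is at most 0.24. It enters the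
    correction and the error bound with opposite signs, which gives 2.16 before passing from N to t,
    within [c0]. As [zr], [zi] are given pointwise, their square is bounded by an explicit function
    with a known integral. The tangent line of the logarithm is linear in the square of |zeta|, so
    one majorant serves both inequalities. [H0] enters through T/(T-H) <= H0/(H0-H) and through the
    monotonicity of the bracket, where the endpoints 0.5208 and 0.9723 come into play. *)

(** * Monotonicity, increments of plane curves, convexity of powers *)

Lemma nondecreasing_of_derive (f df : R -> R) (a b : R) :
  a <= b ->
  (forall x, a <= x <= b -> is_derive f x (df x)) ->
  (forall x, a <= x <= b -> 0 <= df x) ->
  f a <= f b.
Proof.
  intros Hab Hd Hp.
  destruct (MVT_gen f a b df) as [c [Hc Heq]].
  - intros x Hx. rewrite Rmin_left, Rmax_right in Hx by lra. apply Hd; lra.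
  - intros x Hx. rewrite Rmin_left, Rmax_right in Hx by lra.
    apply continuity_pt_filterlim, (ex_derive_continuous f x).
    exists (df x). apply Hd; lra.
  - rewrite Rmin_left, Rmax_right in Hc by lra.
    assert (0 <= df c) by (apply Hp; lra). nra.
Qed.

Lemma Cmod_sqr (z : C) : Cmod z ^ 2 = fst z ^ 2 + snd z ^ 2.
Proof.
  unfold Cmod. apply pow2_sqrt. nra.
Qed.

Lemma Cmod_le_of_sqr (z : C) (m : R) :
  0 <= m -> fst z ^ 2 + snd z ^ 2 <= m ^ 2 -> Cmod z <= m.
Proof.
  intros Hm Hz. rewrite <- Cmod_sqr in Hz.
  pose proof (Cmod_ge_0 z). nra.
Qed.

(* The derivative of the projection on the direction of the increment is
   compared with [g], so that no vector-valued integral is needed. *)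
Lemma Cmod_increment_le (F1 F2 G f1 f2 g : R -> R) (a b : R) :
  a <= b ->
  (forall x, a <= x <= b -> is_derive F1 x (f1 x)) ->
  (forall x, a <= x <= b -> is_derive F2 x (f2 x)) ->
  (forall x, a <= x <= b -> is_derive G x (g x)) ->
  (forall x, a <= x <= b -> 0 <= g x) ->
  (forall x, a <= x <= b -> f1 x ^ 2 + f2 x ^ 2 <= g x ^ 2) ->
  Cmod (F1 b - F1 a, F2 b - F2 a) <= G b - G a.
Proof.
  intros Hab H1 H2 HG Hg Hle.
  set (u := F1 b - F1 a); set (v := F2 b - F2 a); set (m := Cmod (u, v)).
  assert (Hm : m ^ 2 = u ^ 2 + v ^ 2) by apply Cmod_sqr.
  assert (Hm0 : 0 <= m) by apply Cmod_ge_0.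
  assert (HGab : G a <= G b) by (apply nondecreasing_of_derive with g; auto).
  assert (Hdir : m * G a - (u * F1 a + v * F2 a) <= m * G b - (u * F1 b + v * F2 b)).
  { apply (nondecreasing_of_derive (fun x => m * G x - (u * F1 x + v * F2 x))
      (fun x => m * g x - (u * f1 x + v * f2 x))); auto.
    - intros x Hx.
      apply (is_derive_minus (fun x => m * G x) (fun x => u * F1 x + v * F2 x)).
      + apply (is_derive_scal G). auto.
      + apply (is_derive_plus (fun x => u * F1 x) (fun x => v * F2 x)).
        * apply (is_derive_scal F1). auto.
        * apply (is_derive_scal F2). auto.
    - intros x Hx. specialize (Hg x Hx). specialize (Hle x Hx).
      set (p := f1 x) in *; set (q := f2 x) in *; set (r := g x) in *.
      assert ((u * p + v * q) ^ 2 <= (m * r) ^ 2).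
      { replace ((m * r) ^ 2) with (m ^ 2 * r ^ 2) by ring. rewrite Hm.
        assert (0 <= (u * q - v * p) ^ 2) by apply pow2_ge_0.
        assert ((u ^ 2 + v ^ 2) * (p ^ 2 + q ^ 2) <= (u ^ 2 + v ^ 2) * r ^ 2).
        { apply Rmult_le_compat_l; [nra | lra]. }
        nra. }
      assert (0 <= m * r) by nra.
      nra. }
  assert (m ^ 2 <= m * (G b - G a)) by (rewrite Hm; unfold u, v in *; nra).
  nra.
Qed.

Lemma ln_ge_1_sub_inv (x : R) : 0 < x -> 1 - / x <= ln x.
Proof.
  intros Hx. pose proof (exp_ineq1_le (- ln x)) as He.
  rewrite exp_Ropp, exp_ln in He by exact Hx. lra.
Qed.

Lemma ln_le_sub_1 (x : R) : 0 < x -> ln x <= x - 1.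
Proof.
  intros Hx. pose proof (exp_ineq1_le (ln x)) as He.
  rewrite exp_ln in He by exact Hx. lra.
Qed.

Lemma Rpower_pos (x y : R) : 0 < Rpower x y.
Proof. apply exp_pos. Qed.

Lemma Rpower_neg_le (x y s : R) :
  0 <= s -> 0 < x <= y -> Rpower y (- s) <= Rpower x (- s).
Proof.
  intros Hs Hxy. rewrite !Rpower_Ropp. apply Rinv_le_contravar.
  - apply Rpower_pos.
  - apply Rle_Rpower_l; assumption.
Qed.

Lemma Rpower_succ (x y : R) : 0 < x -> Rpower x (1 + y) = x * Rpower x y.
Proof. intros Hx. rewrite Rpower_plus, Rpower_1; auto. Qed.

(** Convexity of u^-s: the left side is its tangent at x, evaluated at a. It yields the trapezoid
    bound and, later, the comparison of chord slopes on the two sides of [H0]. *)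
Lemma Rpower_chord (a x s : R) :
  0 < a -> 0 < x -> 0 <= s ->
  Rpower x (- s) * (1 + s * (1 - a / x)) <= Rpower a (- s).
Proof.
  intros Ha Hx Hs.
  replace (Rpower a (- s)) with (Rpower x (- s) * exp (s * ln (x / a))).
  - apply Rmult_le_compat_l; [left; apply Rpower_pos|].
    eapply Rle_trans; [|apply exp_ineq1_le].
    assert (1 - a / x <= ln (x / a)).
    { replace (a / x) with (/ (x / a)) by (field; lra).
      apply ln_ge_1_sub_inv. apply Rdiv_lt_0_compat; lra. }
    nra.
  - unfold Rpower. rewrite <- exp_plus, ln_div by lra. f_equal. ring.
Qed.

Lemma Rpower_trapezoid (a b s : R) :
  0 < a <= b -> 0 <= s < 1 ->
  (Rpower b (1 - s) - Rpower a (1 - s)) / (1 - s)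
  <= (b - a) / 2 * (Rpower a (- s) + Rpower b (- s)).
Proof.
  intros Hab Hs.
  set (T := fun x => (x - a) / 2 * (Rpower a (- s) + Rpower x (- s))
                     - (Rpower x (1 - s) - Rpower a (1 - s)) / (1 - s)).
  assert (HT : T a <= T b).
  { apply (nondecreasing_of_derive T
      (fun x => (Rpower a (- s) - Rpower x (- s) * (1 + s * (1 - a / x))) / 2)); [lra| |].
    - intros x Hx. unfold T. unfold Rpower at 2 3. auto_derive; [lra|].
      fold (Rpower x (- s)). fold (Rpower x (1 - s)).
      replace (1 - s) with (1 + - s) by ring. rewrite Rpower_succ by lra.
      field; lra.
    - intros x Hx.
      assert (Rpower x (- s) * (1 + s * (1 - a / x)) <= Rpower a (- s))
        by (apply Rpower_chord; lra). lra. }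
  unfold T in HT. rewrite !Rminus_diag in HT. unfold Rdiv in *. lra.
Qed.

(** * The function (1/y - cot y)/2 *)

(** The imaginary part of 1/(e^(i phi) - 1) - 1/(i phi) at phi = 2y. *)
Definition hcot (y : R) : R := (/ y - cos y / sin y) / 2.

Lemma sin_ge_mul_cos (y : R) : 0 <= y <= 1 -> y * cos y <= sin y.
Proof.
  intros Hy.
  cut (sin 0 - 0 * cos 0 <= sin y - y * cos y); [rewrite sin_0; lra|].
  apply (nondecreasing_of_derive (fun x => sin x - x * cos x) (fun x => x * sin x)); [lra| |].
  - intros x _. auto_derive; [easy|ring].
  - intros x Hx. pose proof PI_RGT_0. pose proof PI2_1.
    apply Rmult_le_pos; [lra|]. apply sin_ge_0; lra.
Qed.

Lemma sin_pos_of_le_1 (y : R) : 0 < y <= 1 -> 0 < sin y.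
Proof. intros Hy. pose proof PI2_1. apply sin_gt_0; lra. Qed.

Lemma hcot_ge_0 (y : R) : 0 < y <= 1 -> 0 <= hcot y.
Proof.
  intros Hy. unfold hcot.
  pose proof (sin_pos_of_le_1 y Hy) as Hs.
  assert (y * cos y <= sin y) by (apply sin_ge_mul_cos; lra).
  replace (/ y - cos y / sin y) with ((sin y - y * cos y) / (y * sin y)) by (field; lra).
  apply Rmult_le_pos; [|lra]. apply Rdiv_le_0_compat; nra.
Qed.

Lemma cos_ge_1_sub (y : R) : 1 - y ^ 2 / 2 <= cos y.
Proof.
  replace y with (2 * (y / 2)) at 2 by field. rewrite cos_2a_sin.
  assert (sin (y / 2) ^ 2 <= (y / 2) ^ 2); [|nra].
  destruct (Rtotal_order (y / 2) 0) as [Hn|[Hz|Hp]].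
  - pose proof (sin_gt_x (y / 2) Hn). pose proof (SIN_bound (y / 2)).
    destruct (Rle_dec (-1) (y / 2)) as [Hc|Hc]; [|nra].
    assert (sin (y / 2) <= 0); [|nra].
    replace (y / 2) with (- - (y / 2)) by ring. rewrite sin_neg.
    pose proof (sin_pos_of_le_1 (- (y / 2))). lra.
  - rewrite Hz, sin_0. lra.
  - pose proof (sin_lt_x (y / 2) Hp). pose proof (SIN_bound (y / 2)).
    destruct (Rle_dec (y / 2) 1) as [Hc|Hc]; [|nra].
    pose proof (sin_pos_of_le_1 (y / 2)). nra.
Qed.

Lemma hcot_le (y : R) : 0 < y <= 6 / 10 -> hcot y <= 24 / 100.
Proof.
  intros Hy. unfold hcot.
  pose proof (sin_pos_of_le_1 y ltac:(lra)) as Hs.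
  pose proof (sin_ge_mul_cos y ltac:(lra)) as Hsc.
  pose proof (cos_ge_1_sub y) as Hc.
  pose proof (sin_lt_x y ltac:(lra)) as Hlt.
  replace (/ y - cos y / sin y) with ((sin y - y * cos y) / (y * sin y)) by (field; lra).
  apply Rmult_le_reg_r with 2; [lra|].
  replace ((sin y - y * cos y) / (y * sin y) / 2 * 2)
    with ((sin y - y * cos y) / (y * sin y)) by (field; nra).
  apply Rle_div_l; [nra|].
  (* 0.82 = 1 - 0.6^2/2. The numerator is at most y^3/2 and the denominator at least 0.82 y^2. *)
  assert (82 / 100 <= cos y) by nra.
  assert (sin y >= 82 / 100 * y) by nra.
  assert (sin y - y * cos y <= y * (y ^ 2 / 2)) by nra.
  assert (y * (82 / 100 * y) <= y * sin y) by (apply Rmult_le_compat_l; lra).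
  nra.
Qed.

Lemma hcot_le_hcot (x y : R) : 0 < x <= y -> y <= 1 -> hcot x <= hcot y.
Proof.
  intros Hxy Hy.
  apply (nondecreasing_of_derive hcot (fun u => (/ sin u ^ 2 - / u ^ 2) / 2)); [lra| |].
  - intros u Hu. pose proof (sin_pos_of_le_1 u ltac:(lra)) as Hs.
    unfold hcot. auto_derive; [lra|].
    pose proof (sin2_cos2 u) as E. unfold Rsqr in E.
    replace (/ sin u ^ 2) with ((sin u * sin u + cos u * cos u) / sin u ^ 2)
      by (rewrite E; field; lra).
    field; lra.
  - intros u Hu. pose proof (sin_pos_of_le_1 u ltac:(lra)) as Hs.
    pose proof (sin_lt_x u ltac:(lra)) as Hlt.
    assert (/ u ^ 2 <= / sin u ^ 2); [|lra].
    apply Rinv_le_contravar; [nra|nra].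
Qed.

(** * Partial sums of the Dirichlet series *)

(* [cpow s t x] is x^-(s+it). *)
Definition osc (t x : R) : C := (cos (t * ln x), - sin (t * ln x)).
Definition cpow (s t x : R) : C := (RtoC (Rpower x (- s)) * osc t x)%C.

Fixpoint dsum (s t : R) (n : nat) : C :=
  match n with
  | O => RtoC 0
  | S k => (dsum s t k + cpow s t (INR n))%C
  end.

Lemma Cmod_osc (t x : R) : Cmod (osc t x) = 1.
Proof.
  unfold Cmod, osc. cbn [fst snd].
  replace (cos (t * ln x) ^ 2 + (- sin (t * ln x)) ^ 2) with 1; [apply sqrt_1|].
  pose proof (sin2_cos2 (t * ln x)) as E. unfold Rsqr in E. lra.
Qed.

Lemma Cmod_cpow (s t x : R) : Cmod (cpow s t x) = Rpower x (- s).
Proof.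
  unfold cpow. rewrite Cmod_mult, Cmod_osc, Cmod_R, Rmult_1_r.
  apply Rabs_pos_eq. left. apply Rpower_pos.
Qed.

Lemma osc_mult (t x y : R) :
  0 < x -> 0 < y -> osc t (x * y) = (osc t x * osc t y)%C.
Proof.
  intros Hx Hy. unfold osc, Cmult. simpl. rewrite ln_mult by assumption.
  rewrite Rmult_plus_distr_l, cos_plus, sin_plus. f_equal; ring.
Qed.

Lemma cpow_mult (s t x y : R) :
  0 < x -> 0 < y -> cpow s t (x * y) = (cpow s t x * cpow s t y)%C.
Proof.
  intros Hx Hy. unfold cpow.
  rewrite osc_mult, <- Rpower_mult_distr, RtoC_mult by assumption. ring.
Qed.

(** Only the even n carry a minus sign, so the alternating sum is the full sum minus twice its even
    part, and the even part is 2^-z times a sum of half the length. Terms are indexed from zero, so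
    the index [S (2 * m)] means 2(m+1) terms. *)
Lemma eta_partial_sum (s t : R) (m : nat) :
  @eq C
    (sum_f_R0 (eta_term_re s t) (S (2 * m)), sum_f_R0 (eta_term_im s t) (S (2 * m)))
    (dsum s t (2 * S m) - RtoC 2 * cpow s t 2 * dsum s t (S m))%C.
Proof.
  assert (Hterm : forall k, (eta_term_re s t k, eta_term_im s t k)
                            = (RtoC ((-1) ^ k) * cpow s t (INR (S k)))%C).
  { intros k. unfold eta_term_re, eta_term_im, cpow, osc, Cmult, RtoC.
    cbn [fst snd]. apply injective_projections; cbn [fst snd]; ring. }
  assert (Hadd : forall a b c d : R, (a + b, c + d) = ((a, c) + (b, d))%C) by reflexivity.
  assert (Hev : forall k, (-1) ^ (2 * k) = 1) by (intros k; rewrite pow_1_even; reflexivity).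
  assert (Hdouble : forall k, cpow s t (INR (2 * S k)) = (cpow s t 2 * cpow s t (INR (S k)))%C).
  { intros k. rewrite mult_INR. simpl (INR 2). replace (1 + 1) with 2 by ring.
    apply cpow_mult; [lra|]. apply lt_0_INR. lia. }
  assert (Hm1 : RtoC (-1) = (- RtoC 1)%C).
  { apply injective_projections; cbn; lra. }
  induction m as [|m IH].
  - simpl (2 * 0)%nat. simpl (2 * 1)%nat.
    cbn [sum_f_R0]. rewrite Hadd, !Hterm. cbn [dsum].
    pose proof (Hdouble 0%nat) as H2. simpl (2 * 1)%nat in H2. rewrite H2.
    simpl ((-1) ^ 0). simpl ((-1) ^ 1). rewrite Rmult_1_r, Hm1. ring.
  - set (E := fun k => (sum_f_R0 (eta_term_re s t) k, sum_f_R0 (eta_term_im s t) k) : C).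
    change (E (S (2 * S m)) = (dsum s t (2 * S (S m)) - RtoC 2 * cpow s t 2 * dsum s t (S (S m)))%C).
    change (E (S (2 * m)) = (dsum s t (2 * S m) - RtoC 2 * cpow s t 2 * dsum s t (S m))%C) in IH.
    assert (HE : forall k, E (S k) = (E k + RtoC ((-1) ^ S k) * cpow s t (INR (S (S k))))%C)
      by (intros k; rewrite <- Hterm; reflexivity).
    assert (HD : forall k, dsum s t (S k) = (dsum s t k + cpow s t (INR (S k)))%C)
      by reflexivity.
    rewrite HE. replace (2 * S m)%nat with (S (S (2 * m))) at 1 by lia. rewrite HE, IH.
    replace (S (S (2 * S m))) with (2 * S (S m))%nat by lia.
    rewrite Hdouble.
    replace (2 * S (S m))%nat with (S (S (2 * S m))) by lia.
    rewrite (HD (S (2 * S m))), (HD (2 * S m)%nat), (HD (S m)).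
    replace (S (S (2 * S m))) with (2 * S (S m))%nat by lia.
    rewrite Hdouble.
    replace (S (S (2 * m))) with (2 * S m)%nat by lia.
    rewrite <- (tech_pow_Rmult (-1) (2 * S m)), Hev, Rmult_1_r, Hm1. ring.
Qed.

(** * Comparing one term of the series with the correction *)

(** -1/2 - (i/2) cot y equals 1/(e^(2iy) - 1), and a^-it = e^(2iy) b^-it: the geometric progression
    written as a difference. *)
Lemma osc_sub_mult_cot (t a b : R) :
  let y := t * (ln b - ln a) / 2 in
  sin y <> 0 ->
  ((osc t a - osc t b) * (- / 2, - (cos y / sin y) / 2)%R = osc t b)%C.
Proof.
  intros y Hy. unfold osc, Cminus, Cplus, Copp, Cmult. simpl.
  set (g := t * ln b - y).
  replace (t * ln a) with (g - y) by (unfold g, y; field).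
  replace (t * ln b) with (g + y) by (unfold g; ring).
  rewrite cos_plus, cos_minus, sin_plus, sin_minus. f_equal; field; exact Hy.
Qed.

(** The weight of the integral in the next lemma. Since x^(1-s) increases, x = a is the worst case,
    and there the claim is 1 <= a L e^(sL) with L = log(b/a) and 1 = a (e^L - 1). *)
Lemma convex_weight_ge_0 (a b x s : R) :
  1000 <= b -> a = b - 1 -> a <= x -> 52 / 100 <= s < 1 ->
  0 <= Rpower x (- s) - Rpower b (- s) / (x * (ln b - ln a)).
Proof.
  intros Hb -> Hx Hs. set (a := b - 1) in *. set (L := ln b - ln a).
  assert (Ha : 999 <= a) by (unfold a; lra).
  assert (HL : L = ln (b / a)) by (unfold L; rewrite ln_div; lra).
  assert (HL0 : 0 < L).
  { rewrite HL, <- ln_1. apply ln_increasing; [lra|]. apply Rlt_div_r; unfold a; lra. }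
  assert (HL1 : L <= / a).
  { rewrite HL. eapply Rle_trans; [apply ln_le_sub_1, Rdiv_lt_0_compat; lra|].
    right. unfold a. field. unfold a in *; lra. }
  assert (HL2 : L <= 2 / 1000).
  { eapply Rle_trans; [exact HL1|].
    eapply Rle_trans; [apply Rinv_le_contravar with (x := 999); lra|lra]. }
  assert (HeL : exp L = b / a) by (rewrite HL; apply exp_ln, Rdiv_lt_0_compat; lra).
  (* 0.52 is the lower bound for s, so that the quadratic term is absorbed by e^(sL) >= 1 + sL in
     [Hkey]. *)
  assert (Hexp : exp L <= 1 + L + 52 / 100 * L ^ 2).
  { cut (1 + 0 + 52 / 100 * 0 ^ 2 - exp 0 <= 1 + L + 52 / 100 * L ^ 2 - exp L);
      [rewrite exp_0; lra|].
    apply (nondecreasing_of_derive (fun u => 1 + u + 52 / 100 * u ^ 2 - exp u)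
             (fun u => 1 + 104 / 100 * u - exp u)); [lra| |].
    - intros u _. auto_derive; [easy|field].
    - intros u Hu. pose proof (exp_ineq1_le (- u)) as He. rewrite exp_Ropp in He.
      pose proof (exp_pos u) as Hp.
      assert (exp u * (1 - u) <= 1).
      { apply Rmult_le_reg_l with (/ exp u); [apply Rinv_0_lt_compat; lra|].
        rewrite <- Rmult_assoc, Rinv_l by lra. lra. }
      nra. }
  assert (Hkey : 1 <= a * L * exp (s * L)).
  { assert (1 = a * (exp L - 1)) as -> by (rewrite HeL; unfold a; field; unfold a in *; lra).
    rewrite Rmult_assoc. apply Rmult_le_compat_l; [lra|].
    pose proof (exp_ineq1_le (s * L)). nra. }
  assert (Hdec : a * Rpower a (- s) <= x * Rpower x (- s)).
  { rewrite <- !Rpower_succ by lra. apply Rle_Rpower_l; lra. }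
  assert (Hba : Rpower a (- s) = Rpower b (- s) * exp (s * L)).
  { unfold Rpower, L. rewrite <- exp_plus. f_equal. ring. }
  pose proof (Rpower_pos b (- s)) as Hpb.
  assert (Rpower b (- s) <= L * (x * Rpower x (- s))).
  { apply Rle_trans with (L * (a * Rpower a (- s))); [rewrite Hba; nra|].
    apply Rmult_le_compat_l; lra. }
  assert (Rpower b (- s) / (x * L) <= Rpower x (- s)); [|lra].
  apply Rle_div_l; nra.
Qed.

(** The first quotient is the integral of x^-z over [a, b], the second is b^-s times that of
    x^-it/(xL). Their difference integrates x^-it against the nonnegative weight [g], so its modulus
    is at most the integral of [g]. That integral is the one of x^-s minus b^-s, and the trapezoid
    rule bounds it. *)
Lemma Cmod_main_difference_le (s t a b : R) :
  1000 <= b -> a = b - 1 -> 52 / 100 <= s < 1 -> 0 < t ->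
  let L := ln b - ln a in
  Cmod ((RtoC a * cpow s t a - RtoC b * cpow s t b) / (s - 1, t)%R
        - RtoC (Rpower b (- s)) * (osc t a - osc t b) / (0, t * L)%R)
  <= (Rpower a (- s) - Rpower b (- s)) / 2.
Proof.
  intros Hb Hab Hs Ht L.
  assert (HL0 : 0 < L).
  { unfold L. pose proof (ln_increasing a b). lra. }
  set (D := (1 - s) ^ 2 + t ^ 2).
  assert (HD : 0 < D) by (unfold D; nra).
  set (K := Rpower b (- s)).
  set (F1 := fun x => Rpower x (1 - s) * ((1 - s) * cos (t * ln x) + t * sin (t * ln x)) / D
                      - K * sin (t * ln x) / (t * L)).
  set (F2 := fun x => Rpower x (1 - s) * (t * cos (t * ln x) - (1 - s) * sin (t * ln x)) / D
                      - K * cos (t * ln x) / (t * L)).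
  set (G := fun x => Rpower x (1 - s) / (1 - s) - K * ln x / L).
  set (g := fun x => Rpower x (- s) - K / (x * L)).
  assert (Hpow : forall x, 0 < x -> Rpower x (1 - s) = x * Rpower x (- s)).
  { intros x Hx. replace (1 - s) with (1 + - s) by ring. apply Rpower_succ, Hx. }
  replace ((RtoC a * cpow s t a - RtoC b * cpow s t b) / (s - 1, t)%R
           - RtoC K * (osc t a - osc t b) / (0, t * L)%R)%C
    with (F1 b - F1 a, F2 b - F2 a).
  - eapply Rle_trans.
    + apply (Cmod_increment_le F1 F2 G (fun x => g x * cos (t * ln x))
               (fun x => - (g x * sin (t * ln x))) g); [lra| | | | |].
      * intros x Hx. unfold F1, g. unfold Rpower at 1. auto_derive; [lra|].
        fold (Rpower x (1 - s)). rewrite Hpow by lra. unfold D. field.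
        fold D. lra.
      * intros x Hx. unfold F2, g. unfold Rpower at 1. auto_derive; [lra|].
        fold (Rpower x (1 - s)). rewrite Hpow by lra. unfold D. field.
        fold D. lra.
      * intros x Hx. unfold G, g. unfold Rpower at 1. auto_derive; [lra|].
        fold (Rpower x (1 - s)). rewrite Hpow by lra. field. lra.
      * intros x Hx. apply convex_weight_ge_0; lra.
      * intros x Hx. pose proof (sin2_cos2 (t * ln x)) as E. unfold Rsqr in E.
        right. transitivity (g x ^ 2 * (sin (t * ln x) * sin (t * ln x)
                                        + cos (t * ln x) * cos (t * ln x))); [ring|].
        rewrite E. ring.
    + pose proof (Rpower_trapezoid a b s ltac:(lra) ltac:(lra)) as Htr.
      replace (b - a) with 1 in Htr by lra. fold K in Htr.
      replace (G b - G a) with ((Rpower b (1 - s) - Rpower a (1 - s)) / (1 - s) - K).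
      * lra.
      * unfold G, L. field. fold L. lra.
  - unfold F1, F2. rewrite !Hpow by lra. unfold cpow. fold K.
    unfold osc, Cdiv, Cinv, Cminus, Cplus, Copp, Cmult, RtoC. simpl.
    unfold D. apply injective_projections; simpl; field; repeat split; try lra;
    fold D; nra.
Qed.

(** * Identifying zeta through the eta series *)

Lemma is_lim_seq_Rpower_neg (s : R) :
  0 < s -> is_lim_seq (fun n => Rpower (INR (S n)) (- s)) 0.
Proof.
  intros Hs. apply is_lim_seq_spec. intros [eps Heps]. simpl.
  destruct (INR_unbounded (Rpower eps (- / s))) as [N HN].
  exists N. intros n Hn. rewrite Rminus_0_r, Rabs_pos_eq by (left; apply Rpower_pos).
  assert (HnN : Rpower eps (- / s) < INR (S n)).
  { eapply Rlt_le_trans; [exact HN|]. apply le_INR. lia. }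
  assert (Heq : eps = Rpower (Rpower eps (- / s)) (- s)).
  { rewrite Rpower_mult. replace (- / s * - s) with 1 by (field; lra).
    rewrite Rpower_1; auto. }
  rewrite Heq, !Rpower_Ropp with (y := s). apply Rinv_lt_contravar.
  - apply Rmult_lt_0_compat; apply Rpower_pos.
  - apply Rlt_Rpower_l; [exact Hs|]. split; [apply Rpower_pos|exact HnN].
Qed.

Lemma is_lim_seq_dist (u : nat -> R) (l : R) :
  is_lim_seq u l -> is_lim_seq (fun n => Rabs (l - u n)) 0.
Proof.
  intros Hu. replace 0 with (Rabs (l - l)) by (rewrite Rminus_diag; apply Rabs_R0).
  apply (is_lim_seq_abs (fun n => l - u n) (l - l)).
  apply is_lim_seq_minus'; [apply is_lim_seq_const | exact Hu].
Qed.

Lemma Cmod_le_Rabs_add (x y : R) : Cmod (x, y) <= Rabs x + Rabs y.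
Proof.
  pose proof (Rabs_pos x). pose proof (Rabs_pos y).
  apply Cmod_le_of_sqr; simpl; [lra|].
  pose proof (pow2_abs x). pose proof (pow2_abs y). nra.
Qed.

Lemma two_cpow_2_neq_1 (s t : R) : s <> 1 -> (RtoC 2 * cpow s t 2)%C <> RtoC 1.
Proof.
  intros Hs E. apply (f_equal Cmod) in E.
  rewrite Cmod_mult, Cmod_cpow, !Cmod_R, !Rabs_pos_eq in E by lra.
  rewrite <- Rpower_succ in E by lra.
  apply (f_equal ln) in E. unfold Rpower in E. rewrite ln_exp, ln_1 in E.
  pose proof ln_lt_2. apply Rmult_integral in E. lra.
Qed.

(** Even eta partial sums suffice, since the whole series converges. The factor 1 - 2^(1-z) can be
    cancelled because |2^(1-z)| = 2^(1-s) differs from 1. Both the strip and the half-line s > 1, t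
    = 0 are identified in this way. *)
Lemma is_zeta_eq (s t zr zi : R) (Z : C) :
  s <> 1 -> is_zeta s t zr zi ->
  is_lim_seq (fun m => Cmod (dsum s t (2 * S m) - RtoC 2 * cpow s t 2 * dsum s t (S m)
                             - (1 - RtoC 2 * cpow s t 2) * Z)) 0 ->
  @eq C (zr, zi) Z.
Proof.
  intros Hs (er & ei & Hr & Hi & E1 & E2) Hlim.
  set (q := (RtoC 2 * cpow s t 2)%C) in *.
  assert (Hq : (RtoC 1 - q)%C <> RtoC 0).
  { intros E. apply (two_cpow_2_neq_1 s t Hs). fold q.
    transitivity (RtoC 1 - (RtoC 1 - q))%C; [ring|]. rewrite E. ring. }
  assert (Hz : ((zr, zi) * (1 - q))%C = (er, ei)).
  { rewrite <- E1, <- E2. unfold q, cpow, osc.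
    replace (1 - s) with (1 + - s) by ring. rewrite Rpower_succ by lra.
    apply injective_projections; simpl; ring. }
  assert (Hsub : filterlim (fun m => S (2 * m)) eventually eventually).
  { intros P [N HN]. exists N. intros n Hn. apply HN. lia. }
  apply is_lim_seq_Reals, (is_lim_seq_subseq _ _ _ Hsub) in Hr.
  apply is_lim_seq_Reals, (is_lim_seq_subseq _ _ _ Hsub) in Hi.
  assert (Herr : Cmod ((er, ei) - (1 - q) * Z) <= 0 + 0 + 0).
  { refine (is_lim_seq_le (fun _ => Cmod ((er, ei) - (1 - q) * Z)) _ _ (0 + 0 + 0) _
              (is_lim_seq_const _)
              (is_lim_seq_plus' _ _ _ _
                 (is_lim_seq_plus' _ _ _ _ (is_lim_seq_dist _ _ Hr) (is_lim_seq_dist _ _ Hi))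
                 Hlim)).
    intros m. cbv beta.
    rewrite <- eta_partial_sum.
    set (a := sum_f_R0 _ _). set (b := sum_f_R0 _ _).
    replace ((er, ei) - (1 - q) * Z)%C
      with ((er - a, ei - b)%R + ((a, b) - (1 - q) * Z))%C.
    - eapply Rle_trans; [apply Cmod_triangle|]. apply Rplus_le_compat_r, Cmod_le_Rabs_add.
    - apply injective_projections; simpl; ring. }
  assert (E : ((er, ei) - (1 - q) * Z)%C = RtoC 0).
  { apply Cmod_eq_0. pose proof (Cmod_ge_0 ((er, ei) - (1 - q) * Z)). lra. }
  rewrite <- Hz in E.
  assert (E3 : ((1 - q) * ((zr, zi) - Z))%C = RtoC 0) by (rewrite <- E; ring).
  destruct (Ceq_dec ((zr, zi) - Z)%C (RtoC 0)) as [E4|E4].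
  - transitivity ((zr, zi) - Z + Z)%C; [|rewrite E4; ring].
    apply injective_projections; simpl; ring.
  - exfalso. exact (Cmult_neq_0 _ _ Hq E4 E3).
Qed.

(** * Approximation of zeta by a partial sum *)

Definition phase (t x : R) : R := t * (ln x - ln (x - 1)) / 2.

(* The correction is x^(1-z)/(z-1) + x^-z w with w = 1/(e^(i phi) - 1) - 1/(i phi),
   phi = 2 * phase: this w sums the geometric progression approximating n^-z near x. *)
Definition corr (s t x : R) : C :=
  (RtoC x * cpow s t x / (s - 1, t)%R
   + cpow s t x * (- / 2, hcot (phase t x))%R)%C.

(** The telescoping majorant. The 1 collects two halves, one from the main difference and one from
    Re w = -1/2; the [hcot] term comes from Im w. *)
Definition corr_var (s t x : R) : R := Rpower x (- s) * (1 + hcot (phase t x)).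

Lemma phase_bounds (t x : R) :
  999 <= x -> 0 < t <= x + 1 -> 0 < phase t x <= 51 / 100.
Proof.
  intros Hx Ht. unfold phase.
  assert (Hl : 0 < ln x - ln (x - 1)) by (pose proof (ln_increasing (x - 1) x); lra).
  assert (Hu : ln x - ln (x - 1) <= / (x - 1)).
  { rewrite <- ln_div by lra.
    eapply Rle_trans; [apply ln_le_sub_1, Rdiv_lt_0_compat; lra|].
    right. field. lra. }
  split; [nra|].
  assert ((x + 1) * / (x - 1) <= 102 / 100) by (apply Rle_div_l; lra).
  assert (t * (ln x - ln (x - 1)) <= (x + 1) * / (x - 1)); [|lra].
  apply Rmult_le_compat; lra.
Qed.

Lemma phase_succ_le (t x : R) : 1 < x -> 0 < t -> phase t (x + 1) <= phase t x.
Proof.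
  intros Hx Ht. unfold phase. replace (x + 1 - 1) with x by ring.
  assert (ln (x + 1) - ln x <= ln x - ln (x - 1)); [|nra].
  rewrite <- !ln_div by lra.
  apply Rcomplements.ln_le; [apply Rdiv_lt_0_compat; lra|].
  apply Rle_div_l; [lra|]. replace (x / (x - 1) * x) with (x * x / (x - 1)) by (field; lra).
  apply Rle_div_r; nra.
Qed.

Lemma corr_var_ge_0 (s t x : R) : 999 <= x -> 0 < t <= x + 1 -> 0 <= corr_var s t x.
Proof.
  intros Hx Ht. unfold corr_var. pose proof (phase_bounds t x Hx Ht).
  pose proof (hcot_ge_0 (phase t x) ltac:(lra)). pose proof (Rpower_pos x (- s)). nra.
Qed.

(** Writing b^-it as a^-it minus their difference, and w at b as [vb] - 1/(i t L), turns the b^-z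
    subtracted into a cancellation by [osc_sub_mult_cot]. What is left is [X], the main difference,
    and [Y], a^-it times the change of x^-s w. In [Y] the imaginary part has a known sign because
    x^-s and [hcot (phase t x)] both decrease in x, so no variation is lost. *)
Lemma Cmod_corr_step_le (s t a : R) :
  52 / 100 <= s < 1 -> 999 <= a -> 0 < t <= a + 1 ->
  Cmod (corr s t a - corr s t (a + 1) - cpow s t (a + 1))
  <= corr_var s t a - corr_var s t (a + 1).
Proof.
  intros Hs Ha Ht. set (b := a + 1) in *.
  assert (Hb : 1000 <= b) by (unfold b; lra).
  assert (Hab : a = b - 1) by (unfold b; ring).
  pose proof (phase_bounds t a ltac:(lra) ltac:(lra)) as Hpa.
  pose proof (phase_bounds t b ltac:(lra) ltac:(lra)) as Hpb.
  pose proof (phase_succ_le t a ltac:(lra) ltac:(lra)) as Hph. fold b in Hph.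
  set (xa := hcot (phase t a)). set (xb := hcot (phase t b)).
  assert (Hxb0 : 0 <= xb) by (apply hcot_ge_0; lra).
  assert (Hxab : xb <= xa) by (apply hcot_le_hcot; lra).
  set (Pa := Rpower a (- s)). set (Pb := Rpower b (- s)).
  assert (HPab : Pb <= Pa) by (apply Rpower_neg_le; lra).
  pose proof (Rpower_pos b (- s)) as HPb. fold Pb in HPb.
  set (L := ln b - ln a).
  assert (Hpbe : phase t b = t * L / 2) by (unfold phase, L; rewrite <- Hab; reflexivity).
  set (y := t * L / 2) in *.
  assert (Hsin : 0 < sin y) by (apply sin_pos_of_le_1; lra).
  set (vb := (- / 2, - (cos y / sin y) / 2) : C).
  assert (Hv : ((osc t a - osc t b) * vb = osc t b)%C).
  { apply osc_sub_mult_cot. fold L. fold y. lra. }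
  assert (Hwb : ((- / 2, xb) : C) = (vb - / (0, t * L)%R)%C).
  { unfold xb, vb, hcot. rewrite Hpbe. unfold Cinv, Cminus, Cplus, Copp. simpl.
    assert (HtL : t * L = 2 * y) by (unfold y; field). rewrite HtL.
    apply injective_projections; simpl; field; lra. }
  set (X := ((RtoC a * cpow s t a - RtoC b * cpow s t b) / (s - 1, t)%R
        - RtoC Pb * (osc t a - osc t b) / (0, t * L)%R)%C).
  set (Y := (osc t a * (RtoC Pa * (- / 2, xa)%R - RtoC Pb * (- / 2, xb)%R))%C).
  replace (corr s t a - corr s t b - cpow s t b)%C with (X + Y)%C.
  - eapply Rle_trans; [apply Cmod_triangle|].
    assert (HX : Cmod X <= (Pa - Pb) / 2)
      by (apply (Cmod_main_difference_le s t a b); lra).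
    assert (HY : Cmod Y <= (Pa - Pb) / 2 + (Pa * xa - Pb * xb)).
    { unfold Y. rewrite Cmod_mult, Cmod_osc, Rmult_1_l.
      replace (RtoC Pa * (- / 2, xa)%R - RtoC Pb * (- / 2, xb)%R)%C
        with (((Pb - Pa) / 2, Pa * xa - Pb * xb) : C)
        by (apply injective_projections; simpl; field).
      eapply Rle_trans; [apply Cmod_le_Rabs_add|].
      rewrite Rabs_left1 by lra. rewrite Rabs_pos_eq; [lra|]. nra. }
    unfold corr_var. fold xa xb Pa Pb. lra.
  - unfold corr. fold xa xb. unfold X, Y. rewrite Hwb. unfold cpow. fold Pa Pb.
    assert (E : ((osc t a - osc t b) * vb - osc t b = 0)%C) by (rewrite Hv; ring).
    unfold Cdiv.
    match goal with |- _ = ?r =>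
      transitivity (r - RtoC Pb * ((osc t a - osc t b) * vb - osc t b))%C end.
    + ring.
    + rewrite E. ring.
Qed.

Lemma Cmod_corrected_sum_dist_le (s t : R) (n k : nat) :
  52 / 100 <= s < 1 -> 999 <= INR n -> 0 < t <= INR n + 1 ->
  Cmod (dsum s t n + corr s t (INR n) - (dsum s t (n + k) + corr s t (INR (n + k))))
  <= corr_var s t (INR n) - corr_var s t (INR (n + k)).
Proof.
  intros Hs Hn Ht. induction k as [|k IH].
  - rewrite Nat.add_0_r, Rminus_diag.
    match goal with |- Cmod ?z <= 0 => replace z with (RtoC 0) by ring end.
    rewrite Cmod_0. lra.
  - rewrite Nat.add_succ_r. set (m := (n + k)%nat) in *.
    assert (Hm : INR n <= INR m) by (apply le_INR; lia).
    pose proof (Cmod_corr_step_le s t (INR m) Hs ltac:(lra) ltac:(lra)) as Hst.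
    rewrite <- S_INR in Hst.
    match goal with |- Cmod ?z <= _ =>
      replace z with ((dsum s t n + corr s t (INR n) - (dsum s t m + corr s t (INR m)))
        + (corr s t (INR m) - corr s t (INR (S m)) - cpow s t (INR (S m))))%C end.
    + eapply Rle_trans; [apply Cmod_triangle|]. lra.
    + cbn [dsum]. ring.
Qed.

Lemma corr_var_le (s t x : R) :
  999 <= x -> 0 < t <= x + 1 -> corr_var s t x <= 2 * Rpower x (- s).
Proof.
  intros Hx Ht. unfold corr_var. pose proof (phase_bounds t x Hx Ht).
  pose proof (hcot_le (phase t x) ltac:(lra)). pose proof (Rpower_pos x (- s)). nra.
Qed.

Lemma corrected_sum_limit (s t : R) :
  52 / 100 <= s < 1 -> 0 < t ->
  exists Z : C, forall n : nat, 999 <= INR n -> t <= INR n + 1 ->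
    Cmod (dsum s t n + corr s t (INR n) - Z) <= corr_var s t (INR n).
Proof.
  intros Hs Ht.
  set (E := fun n => (dsum s t n + corr s t (INR n))%C).
  assert (Hfst : forall z : C, Rabs (fst z) <= Cmod z).
  { intros z. eapply Rle_trans; [apply Rmax_l | apply Rmax_Cmod]. }
  assert (Hsnd : forall z : C, Rabs (snd z) <= Cmod z).
  { intros z. eapply Rle_trans; [apply Rmax_r | apply Rmax_Cmod]. }
  assert (Hdist : forall n m, 999 <= INR n -> t <= INR n + 1 -> (n <= m)%nat ->
            Cmod (E n - E m) <= corr_var s t (INR n)).
  { intros n m Hn Htn Hnm. replace m with (n + (m - n))%nat by lia.
    pose proof (Cmod_corrected_sum_dist_le s t n (m - n) Hs Hn ltac:(lra)) as Hd.
    assert (INR n <= INR (n + (m - n))) by (apply le_INR; lia).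
    pose proof (corr_var_ge_0 s t (INR (n + (m - n))) ltac:(lra) ltac:(lra)).
    unfold E. lra. }
  assert (Hcauchy : forall eps : posreal, exists N : nat, forall n m,
            (N <= n)%nat -> (N <= m)%nat -> Cmod (E n - E m) < eps).
  { intros [eps Heps]. simpl.
    pose proof (is_lim_seq_Rpower_neg s ltac:(lra)) as Hl.
    apply is_lim_seq_spec in Hl. destruct (Hl (mkposreal (eps / 4) ltac:(lra))) as [N0 HN0].
    cbn [pos] in HN0. destruct (INR_unbounded (Rmax 999 t)) as [N1 HN1].
    assert (Hone : forall n m, (S N0 + N1 <= n)%nat -> (n <= m)%nat -> Cmod (E n - E m) < eps).
    { intros n m Hn Hm.
      assert (INR N1 <= INR n) by (apply le_INR; lia).
      pose proof (Rmax_l 999 t). pose proof (Rmax_r 999 t).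
      eapply Rle_lt_trans; [apply Hdist; [lra|lra|exact Hm]|].
      eapply Rle_lt_trans; [apply corr_var_le; lra|].
      destruct n as [|n]; [lia|]. specialize (HN0 n ltac:(lia)).
      rewrite Rminus_0_r, Rabs_pos_eq in HN0 by (left; apply Rpower_pos). lra. }
    exists (S N0 + N1)%nat. intros n m Hn Hm.
    destruct (Nat.le_ge_cases n m) as [Hnm|Hnm]; [apply Hone; auto|].
    replace (E n - E m)%C with (- (E m - E n))%C by ring. rewrite Cmod_opp. apply Hone; auto. }
  assert (H1 : ex_finite_lim_seq (fun n => fst (E n))).
  { apply ex_lim_seq_cauchy_corr. intros eps. destruct (Hcauchy eps) as [N HN].
    exists N. intros n m Hn Hm. eapply Rle_lt_trans; [apply (Hfst (E n - E m)%C)|]. auto. }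
  assert (H2 : ex_finite_lim_seq (fun n => snd (E n))).
  { apply ex_lim_seq_cauchy_corr. intros eps. destruct (Hcauchy eps) as [N HN].
    exists N. intros n m Hn Hm. eapply Rle_lt_trans; [apply (Hsnd (E n - E m)%C)|]. auto. }
  destruct H1 as [z1 Hz1], H2 as [z2 Hz2].
  exists (z1, z2). intros n Hn Htn. fold (E n).
  assert (Hle : Cmod (E n - (z1, z2)) <= corr_var s t (INR n) + (0 + 0)).
  { refine (is_lim_seq_le_loc (fun _ => Cmod (E n - (z1, z2))) _ _ _ _ (is_lim_seq_const _)
      (is_lim_seq_plus' _ _ _ _ (is_lim_seq_const (corr_var s t (INR n)))
         (is_lim_seq_plus' _ _ _ _ (is_lim_seq_dist _ _ Hz1) (is_lim_seq_dist _ _ Hz2)))).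
    exists n. intros m Hm.
    replace (E n - (z1, z2))%C with ((E n - E m) + - (z1 - fst (E m), z2 - snd (E m))%R)%C
      by (apply injective_projections; simpl; ring).
    eapply Rle_trans; [apply Cmod_triangle|]. rewrite Cmod_opp.
    apply Rplus_le_compat; [apply Hdist; auto | apply Cmod_le_Rabs_add]. }
  lra.
Qed.

Lemma Cmod_weight_le_1 (t x : R) :
  999 <= x -> 0 < t <= x + 1 -> Cmod (- / 2, hcot (phase t x)) <= 1.
Proof.
  intros Hx Ht. pose proof (phase_bounds t x Hx Ht).
  pose proof (hcot_le (phase t x) ltac:(lra)). pose proof (hcot_ge_0 (phase t x) ltac:(lra)).
  apply Cmod_le_of_sqr; simpl; nra.
Qed.

(** For b = 2a one has b^(1-z) = q a^(1-z), with q = 2^(1-z), so the large terms of [corr] cancel in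
    D(b) - q D(a) and everything else is O(a^-s). This identifies Z with zeta. *)
Lemma zeta_near_corrected_sum (s t zr zi : R) (n : nat) :
  52 / 100 <= s < 1 -> is_zeta s t zr zi -> 999 <= INR n -> 0 < t <= INR n + 1 ->
  Cmod (dsum s t n + corr s t (INR n) - (zr, zi)) <= corr_var s t (INR n).
Proof.
  intros Hs Hz Hn Ht.
  destruct (corrected_sum_limit s t Hs ltac:(lra)) as [Z HZ].
  replace ((zr, zi) : C) with Z; [apply HZ; lra|]. symmetry.
  apply (is_zeta_eq s t); [lra|exact Hz|].
  set (q := (RtoC 2 * cpow s t 2)%C).
  set (w := fun m => (- / 2, hcot (phase t (INR m))) : C).
  set (P := fun m => Rpower (INR m) (- s)).
  (* Each of the lengths a and 2a contributes three units of a^-s: two from [corr_var_le] and one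
     from the weight [w]. *)
  set (K := 3 * (1 + Cmod q)).
  apply (is_lim_seq_le_le_loc (fun _ => 0) _ (fun m => K * P (S m))).
  - destruct (INR_unbounded (Rmax 999 t)) as [N1 HN1].
    pose proof (Rmax_l 999 t). pose proof (Rmax_r 999 t).
    exists N1. intros m Hm. cbv beta. split; [apply Cmod_ge_0|].
    set (a := S m). set (b := (2 * a)%nat).
    assert (Ha : INR N1 <= INR a) by (apply le_INR; unfold a; lia).
    assert (Hab : INR b = 2 * INR a) by (unfold b; rewrite mult_INR; reflexivity).
    assert (HPba : P b <= P a) by (apply Rpower_neg_le; lra).
    assert (Hw : forall k, INR a <= INR k -> Cmod (cpow s t (INR k) * w k) <= P k).
    { intros k Hk. rewrite Cmod_mult, Cmod_cpow.
      pose proof (Cmod_weight_le_1 t (INR k) ltac:(lra) ltac:(lra)) as Hw.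
      fold (w k) in Hw. pose proof (Rpower_pos (INR k) (- s)).
      unfold P. nra. }
    assert (HE : forall k, INR a <= INR k ->
              Cmod (dsum s t k + corr s t (INR k) - Z) <= 2 * P k).
    { intros k Hk. eapply Rle_trans; [apply HZ; lra|]. apply corr_var_le; lra. }
    pose proof (Hw a ltac:(lra)) as Hwa. pose proof (Hw b ltac:(lra)) as Hwb.
    pose proof (HE a ltac:(lra)) as HEa. pose proof (HE b ltac:(lra)) as HEb.
    assert (Hcb : (RtoC (INR b) * cpow s t (INR b) = q * (RtoC (INR a) * cpow s t (INR a)))%C).
    { rewrite Hab, cpow_mult, RtoC_mult by lra. unfold q. ring. }
    set (Ea := (dsum s t a + corr s t (INR a) - Z)%C) in *.
    set (Eb := (dsum s t b + corr s t (INR b) - Z)%C) in *.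
    replace (dsum s t b - q * dsum s t a - (1 - q) * Z)%C
      with ((Eb + - (cpow s t (INR b) * w b))
            + - (q * (Ea + - (cpow s t (INR a) * w a))))%C.
    + eapply Rle_trans; [apply Cmod_triangle|]. rewrite Cmod_opp, Cmod_mult.
      pose proof (Cmod_triangle Eb (- (cpow s t (INR b) * w b))) as T1.
      pose proof (Cmod_triangle Ea (- (cpow s t (INR a) * w a))) as T2.
      rewrite Cmod_opp in T1, T2. pose proof (Cmod_ge_0 q).
      set (A := Cmod (Ea + _)) in *.
      assert (Cmod q * A <= Cmod q * (3 * P a)) by (apply Rmult_le_compat_l; lra).
      unfold K. lra.
    + unfold Ea, Eb, corr. fold (w a) (w b). unfold Cdiv. rewrite Hcb. ring.
  - apply is_lim_seq_const.
  - replace 0 with (K * 0) by ring.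
    apply (is_lim_seq_scal_l (fun m => P (S m)) K 0). apply is_lim_seq_Rpower_neg. lra.
Qed.

Lemma zeta_approx (s t zr zi : R) (n : nat) :
  52 / 100 <= s < 1 -> 1000 <= t -> INR n <= t < INR n + 1 -> is_zeta s t zr zi ->
  Cmod ((zr, zi) - dsum s t n) <= c0 * Rpower t (- s).
Proof.
  intros Hs Ht Hn Hz. set (x := INR n) in *.
  pose proof (zeta_near_corrected_sum s t zr zi n Hs Hz ltac:(fold x; lra) ltac:(fold x; lra)) as Hz'.
  fold x in Hz'.
  pose proof (phase_bounds t x ltac:(lra) ltac:(lra)) as Hph.
  pose proof (hcot_le (phase t x) ltac:(lra)) as Hh1.
  pose proof (hcot_ge_0 (phase t x) ltac:(lra)) as Hh0.
  set (h := hcot (phase t x)) in *.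
  pose proof (Rpower_pos x (- s)) as HP.
  (* The -h is there to cancel the h of [corr_var], giving 1.16 + 1 = 2.16 in total. It is
     affordable since x/(z-1) is close to -i, which opposes Im w = h: (1.16-h)^2 - (1-h)^2 >= 0.26
     for h <= 0.24. *)
  assert (Hcorr : Cmod (corr s t x) <= Rpower x (- s) * (116 / 100 - h)).
  { unfold corr. fold h.
    set (D := (s - 1) ^ 2 + t ^ 2).
    assert (HD : t ^ 2 <= D) by (unfold D; nra).
    assert (HDt : 1000 * t <= t ^ 2) by nra.
    assert (HD2 : D <= t ^ 2 + 1) by (unfold D; nra).
    replace (RtoC x * cpow s t x / (s - 1, t)%R + cpow s t x * (- / 2, h)%R)%C
      with (cpow s t x * (x * (s - 1) / D - / 2, h - x * t / D)%R)%C.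
    - rewrite Cmod_mult, Cmod_cpow. apply Rmult_le_compat_l; [lra|].
      apply Cmod_le_of_sqr; cbn [fst snd]; [lra|].
      assert (U1 : 0 <= x * (1 - s) / D <= 5 / 10000).
      { split; [apply Rdiv_le_0_compat; nra|]. apply Rle_div_l; [nra|].
        assert (x * (1 - s) <= t * (48 / 100)) by (apply Rmult_le_compat; lra). lra. }
      assert (U2 : 99 / 100 <= x * t / D <= 1).
      { split; [apply (Rle_div_r (99 / 100)); [nra|] | apply Rle_div_l; [nra|]].
        - assert (999 / 1000 * t * t <= x * t) by (apply Rmult_le_compat_r; lra). lra.
        - assert (x * t <= t * t) by (apply Rmult_le_compat_r; lra). lra. }
      replace (x * (s - 1) / D) with (- (x * (1 - s) / D)) by (field; nra).
      set (u := x * (1 - s) / D) in *. set (v := x * t / D) in *.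
      assert ((- u - / 2) ^ 2 <= 26 / 100) by nra.
      assert ((h - v) ^ 2 <= (1 - h) ^ 2) by nra.
      nra.
    - unfold Cdiv. rewrite (Cmult_comm x), <- Cmult_assoc, <- Cmult_plus_distr_l. f_equal.
      unfold Cinv, Cmult, Cplus, RtoC. simpl.
      apply injective_projections; simpl; unfold D; field; fold D; nra. }
  unfold corr_var in Hz'. fold h in Hz'.
  assert (Hsum : Cmod ((zr, zi) - dsum s t n) <= 216 / 100 * Rpower x (- s)).
  { replace ((zr, zi) - dsum s t n)%C
      with (corr s t x + - (dsum s t n + corr s t x - (zr, zi)))%C by ring.
    eapply Rle_trans; [apply Cmod_triangle|]. rewrite Cmod_opp. lra. }
  eapply Rle_trans; [exact Hsum|].
  (* (t/x)^s <= t/x <= 1.0011 *)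
  assert (Hxt : Rpower x (- s) <= 1002 / 1000 * Rpower t (- s)).
  { replace (Rpower x (- s)) with (Rpower t (- s) * Rpower (t / x) s).
    - rewrite Rmult_comm. apply Rmult_le_compat_r; [left; apply Rpower_pos|].
      assert (H1 : 1 <= t / x) by (apply Rle_div_r; lra).
      apply Rle_trans with (Rpower (t / x) 1); [apply Rle_Rpower; lra|].
      rewrite Rpower_1 by lra. apply Rle_div_l; lra.
    - unfold Rpower. rewrite <- exp_plus, ln_div by lra. f_equal. ring. }
  pose proof (Rpower_pos t (- s)). unfold c0. lra.
Qed.

(** * Mean square of the partial sums *)

Fixpoint sum1 (f : nat -> R) (n : nat) : R :=
  match n with
  | O => 0
  | S k => sum1 f k + f n
  end.

Lemma sum1_le (f g : nat -> R) (n : nat) :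
  (forall k, (1 <= k <= n)%nat -> f k <= g k) -> sum1 f n <= sum1 g n.
Proof.
  induction n as [|n IH]; intros Hfg; cbn [sum1]; [lra|].
  apply Rplus_le_compat; [apply IH; intros; apply Hfg; lia | apply Hfg; lia].
Qed.

Lemma sum1_scal (c : R) (f : nat -> R) (n : nat) :
  sum1 (fun k => c * f k) n = c * sum1 f n.
Proof. induction n as [|n IH]; cbn [sum1]; [ring|rewrite IH; ring]. Qed.

Lemma sum1_plus (f g : nat -> R) (n : nat) :
  sum1 (fun k => f k + g k) n = sum1 f n + sum1 g n.
Proof. induction n as [|n IH]; cbn [sum1]; [ring|rewrite IH; ring]. Qed.

Lemma sum1_ge_0 (f : nat -> R) (n : nat) :
  (forall k, (1 <= k <= n)%nat -> 0 <= f k) -> 0 <= sum1 f n.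
Proof.
  intros Hf. apply Rle_trans with (sum1 (fun k => 0 * f k) n).
  - rewrite sum1_scal. lra.
  - apply sum1_le. intros k Hk. specialize (Hf k Hk). lra.
Qed.

Lemma is_RInt_zero (a b : R) : is_RInt (fun _ => 0) a b 0.
Proof.
  pose proof (is_RInt_const (V := R_NormedModule) a b 0) as E.
  change (scal (b - a) 0) with ((b - a) * 0) in E. rewrite Rmult_0_r in E. exact E.
Qed.

Lemma is_RInt_indicator_ge (f : R -> R) (c a b v : R) :
  a <= b -> c <= b -> is_RInt f (Rmax c a) b v ->
  is_RInt (fun t => if Rle_dec c t then f t else 0) a b v.
Proof.
  intros Hab Hcb Hv. destruct (Rle_dec c a) as [Hca|Hca].
  - rewrite Rmax_right in Hv by lra.
    apply (is_RInt_ext f); [|exact Hv].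
    intros x Hx. rewrite Rmin_left in Hx by lra.
    destruct (Rle_dec c x); [reflexivity|lra].
  - rewrite Rmax_left in Hv by lra.
    replace v with (0 + v) by ring.
    apply (is_RInt_Chasles (V := R_NormedModule) _ a c b 0 v).
    + apply (is_RInt_ext (fun _ => 0)).
      * intros x Hx. rewrite Rmax_right in Hx by lra.
        destruct (Rle_dec c x); [lra|reflexivity].
      * apply is_RInt_zero.
    + apply (is_RInt_ext f); [|exact Hv].
      intros x Hx. rewrite Rmin_left in Hx by lra.
      destruct (Rle_dec c x); [reflexivity|lra].
Qed.

Lemma is_RInt_cos_bound (l a b : R) :
  0 < l -> exists v, is_RInt (fun t => cos (t * l)) a b v /\ v <= 2 / l.
Proof.
  intros Hl. exists (sin (b * l) / l - sin (a * l) / l). split.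
  - apply (is_RInt_derive (fun t => sin (t * l) / l)).
    + intros x _. auto_derive; [lra|field; lra].
    + intros x _. apply (ex_derive_continuous (fun t => cos (t * l))). auto_derive. easy.
  - pose proof (SIN_bound (b * l)). pose proof (SIN_bound (a * l)).
    apply Rmult_le_reg_r with l; [lra|]. field_simplify; lra.
Qed.

Lemma is_RInt_cos_sum_bound (p l : nat -> R) (a b : R) (n : nat) :
  (forall k, (1 <= k <= n)%nat -> 0 <= p k /\ 0 < l k) ->
  exists v, is_RInt (fun t => sum1 (fun k => p k * cos (t * l k)) n) a b v
            /\ v <= 2 * sum1 (fun k => p k / l k) n.
Proof.
  induction n as [|n IH]; intros Hpl.
  - exists 0. cbn [sum1]. split; [|lra].
    apply is_RInt_zero.
  - destruct IH as [v [Hv Hle]]; [intros; apply Hpl; lia|].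
    destruct (Hpl (S n) ltac:(lia)) as [Hp Hl].
    destruct (is_RInt_cos_bound (l (S n)) a b Hl) as [w [Hw Hwle]].
    exists (v + p (S n) * w). cbn [sum1]. split.
    + apply (is_RInt_plus (fun t => sum1 (fun k => p k * cos (t * l k)) n)
               (fun t => p (S n) * cos (t * l (S n)))); [exact Hv|].
      apply (is_RInt_scal (fun t => cos (t * l (S n)))). exact Hw.
    + assert (p (S n) * w <= p (S n) * (2 / l (S n))) by (apply Rmult_le_compat_l; lra).
      unfold Rdiv in *. lra.
Qed.

Definition npow (s : R) (k : nat) : R := Rpower (INR k) (- s).

Lemma npow_pos (s : R) (k : nat) : 0 < npow s k.
Proof. apply Rpower_pos. Qed.

Lemma npow_sqr (s : R) (k : nat) : npow s k * npow s k = npow (2 * s) k.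
Proof. unfold npow. rewrite <- Rpower_plus. f_equal. ring. Qed.

(** The partial sum up to t has a length varying with t. Indicators make it a sum of fixed length n
    on [H, T], which can be integrated term by term. *)
Fixpoint tsum (s : R) (n : nat) (t : R) : C :=
  match n with
  | O => RtoC 0
  | S k => (tsum s k t + if Rle_dec (INR n) t then cpow s t (INR n) else RtoC 0)%C
  end.

Lemma tsum_le (s t : R) (n : nat) : INR n <= t -> tsum s n t = dsum s t n.
Proof.
  induction n as [|n IH]; intros Hn; [reflexivity|].
  cbn [tsum dsum]. rewrite IH.
  - destruct (Rle_dec (INR (S n)) t); [reflexivity|contradiction].
  - rewrite S_INR in Hn. lra.
Qed.

Lemma tsum_floor (s t : R) (n k : nat) :
  INR n <= t < INR n + 1 -> tsum s (n + k) t = dsum s t n.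
Proof.
  intros Hn. induction k as [|k IH].
  - rewrite Nat.add_0_r. apply tsum_le. lra.
  - rewrite Nat.add_succ_r. cbn [tsum]. rewrite IH.
    destruct (Rle_dec (INR (S (n + k))) t) as [Hle|_]; [|ring].
    exfalso. rewrite S_INR, plus_INR in Hle. pose proof (pos_INR k). lra.
Qed.

(** The left side is the cross term in the expansion of the squared modulus of a sum, as pairwise
    cosines. *)
Lemma dsum_mult_conj_cpow (s t b : R) (n : nat) :
  fst (dsum s t n) * fst (cpow s t b) + snd (dsum s t n) * snd (cpow s t b)
  = Rpower b (- s) * sum1 (fun m => npow s m * cos (t * (ln b - ln (INR m)))) n.
Proof.
  induction n as [|n IH]; [cbn [dsum sum1 RtoC fst snd]; ring|].
  cbn [dsum sum1]. rewrite Rmult_plus_distr_l, <- IH.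
  rewrite Rmult_minus_distr_l, cos_minus. unfold npow.
  set (d := dsum s t n). unfold cpow, osc, Cplus, Cmult, RtoC. cbn [fst snd]. ring.
Qed.

(** Adding the term b = n+1 changes the square only for t >= b, where all earlier indicators are 1.
    The diagonal gain is b^-2s times a length at most T-H. Each cosine of frequency l integrates to
    at most 2/l on any interval, and the cross term doubles this: hence the 4. *)
Lemma tsum_mean_square (s H T : R) (n : nat) :
  H <= T -> INR n <= T ->
  exists v, is_RInt (fun t => Cmod (tsum s n t) ^ 2) H T v /\
    v <= (T - H) * sum1 (npow (2 * s)) n
         + 4 * sum1 (fun k => npow s k * sum1 (fun m => npow s m / (ln (INR k) - ln (INR m)))
                                               (pred k)) n.
Proof.
  intros HHT. induction n as [|n IH]; intros HnT.
  - exists 0. cbn [sum1 tsum]. split; [|lra].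
    apply (is_RInt_ext (fun _ => 0)).
    + intros x _. rewrite Cmod_0. symmetry. apply pow_ne_zero. lia.
    + apply is_RInt_zero.
  - destruct IH as [v [Hv Hle]]; [rewrite S_INR in HnT; lra|].
    set (b := INR (S n)) in *. set (d := Rmax b H).
    set (l := fun m => ln b - ln (INR m)).
    assert (Hd : H <= d <= T) by (split; [apply Rmax_r | apply Rmax_lub; lra]).
    destruct (is_RInt_cos_sum_bound (npow s) l d T n) as [w [Hw Hwle]].
    { intros k Hk. split; [left; apply npow_pos|]. unfold l.
      assert (INR k < b) by (apply lt_INR; lia).
      assert (0 < INR k) by (apply lt_0_INR; lia).
      pose proof (ln_increasing (INR k) b). lra. }
    exists (v + (npow (2 * s) (S n) * (T - d) + 2 * npow s (S n) * w)). split.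
    + apply (is_RInt_ext (fun t => Cmod (tsum s n t) ^ 2
        + (if Rle_dec b t then npow (2 * s) (S n)
             + 2 * npow s (S n) * sum1 (fun k => npow s k * cos (t * l k)) n else 0))).
      * intros t _. cbn [tsum]. fold b.
        match goal with |- ?x = ?y => change (@eq R x y) end.
        destruct (Rle_dec b t) as [Hbt|Hbt].
        -- rewrite tsum_le by (unfold b in Hbt; rewrite S_INR in Hbt; lra).
           pose proof (dsum_mult_conj_cpow s t b n) as Hcr.
           change (Rpower b (- s) * sum1 (fun m => npow s m * cos (t * (ln b - ln (INR m)))) n)
             with (npow s (S n) * sum1 (fun k => npow s k * cos (t * l k)) n) in Hcr.
           assert (Hb2 : fst (cpow s t b) ^ 2 + snd (cpow s t b) ^ 2 = npow (2 * s) (S n)).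
           { rewrite <- Cmod_sqr, Cmod_cpow, <- npow_sqr. unfold npow. fold b. ring. }
           rewrite !Cmod_sqr. cbn [Cplus fst snd]. rewrite <- Hb2.
           rewrite Rmult_assoc, <- Hcr. ring.
        -- rewrite Cplus_0_r. ring.
      * apply (is_RInt_plus (fun t => Cmod (tsum s n t) ^ 2)); [exact Hv|].
        apply is_RInt_indicator_ge; [lra|lra|]. fold d.
        apply (is_RInt_plus (fun _ => npow (2 * s) (S n))).
        -- rewrite (Rmult_comm (npow _ _)). apply (is_RInt_const d T (npow (2 * s) (S n))).
        -- apply (is_RInt_scal (fun t => sum1 (fun k => npow s k * cos (t * l k)) n)). exact Hw.
    + cbn [sum1 pred]. fold b.
      pose proof (npow_pos s (S n)) as Hp.
      pose proof (npow_pos (2 * s) (S n)) as Hp2.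
      change (sum1 (fun m => npow s m / (ln b - ln (INR m))) n) with (sum1 (fun m => npow s m / l m) n).
      set (Q := sum1 (fun m => npow s m / l m) n) in *.
      assert (npow s (S n) * w <= npow s (S n) * (2 * Q)) by (apply Rmult_le_compat_l; lra).
      assert (npow (2 * s) (S n) * (T - d) <= npow (2 * s) (S n) * (T - H))
        by (apply Rmult_le_compat_l; lra).
      lra.
Qed.

(** * The off-diagonal sum *)

(** The form with u <> 1 covers both the growing sums (u < 1) and the tail of zeta (u > 1). *)
Lemma Rpower_increment_ge (a b u : R) :
  0 < a <= b -> 0 <= u -> u <> 1 ->
  (b - a) * Rpower b (- u) <= (Rpower b (1 - u) - Rpower a (1 - u)) / (1 - u).
Proof.
  intros Hab Hu Hu1.
  set (f := fun x => Rpower x (1 - u) / (1 - u) - x * Rpower b (- u)).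
  assert (Hf : f a <= f b).
  { apply (nondecreasing_of_derive f (fun x => Rpower x (- u) - Rpower b (- u))); [lra| |].
    - intros x Hx. unfold f. unfold Rpower at 1. auto_derive; [lra|].
      fold (Rpower x (1 - u)). replace (1 - u) with (1 + - u) at 1 2 by ring.
      rewrite Rpower_succ by lra. field. lra.
    - intros x Hx. pose proof (Rpower_neg_le x b u ltac:(lra) ltac:(lra)). lra. }
  unfold f, Rdiv in *. lra.
Qed.

Lemma sum_npow_le (u : R) (n : nat) :
  0 <= u < 1 -> (1 <= n)%nat ->
  sum1 (npow u) n <= (Rpower (INR n) (1 - u) - u) / (1 - u).
Proof.
  intros Hu Hn. induction Hn as [|n Hn IH].
  - cbn [sum1]. unfold npow. simpl INR. unfold Rpower. rewrite ln_1, !Rmult_0_r, exp_0.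
    right. field. lra.
  - cbn [sum1]. assert (0 < INR n) by (apply lt_0_INR; lia).
    assert (npow u (S n) <= (Rpower (INR (S n)) (1 - u) - Rpower (INR n) (1 - u)) / (1 - u)).
    { replace (npow u (S n)) with ((INR (S n) - INR n) * Rpower (INR (S n)) (- u)).
      - apply Rpower_increment_ge; rewrite ?S_INR; lra.
      - unfold npow. rewrite (S_INR n) at 1. ring. }
    unfold Rdiv in *. lra.
Qed.

Lemma sum_inv_distance_le (n : nat) :
  (1 <= n)%nat -> sum1 (fun m => / (INR (S n) - INR m)) n <= 1 + ln (INR n).
Proof.
  intros Hn. destruct n as [|n]; [lia|]. cbn [sum1].
  (* Each reciprocal 1/x with x >= 2 is at most log x - log(x-1), which telescopes. The term at
     distance 1, where log(x-1) would be singular, stays outside and supplies the 1. *)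
  assert (Hj : forall j, (j <= n)%nat ->
    sum1 (fun m => / (INR (S (S n)) - INR m)) j <= ln (INR (S n)) - ln (INR (S n) - INR j)).
  { induction j as [|j IHj]; intros Hj.
    - cbn [sum1]. simpl (INR 0). rewrite Rminus_0_r. lra.
    - cbn [sum1]. specialize (IHj ltac:(lia)).
      assert (INR (S j) <= INR n) by (apply le_INR; lia).
      rewrite !S_INR in *. set (x := INR n + 1 - INR j) in *.
      replace (INR n + 1 + 1 - (INR j + 1)) with x by (unfold x; ring).
      replace (INR n + 1 - (INR j + 1)) with (x - 1) by (unfold x; ring).
      assert (Hx : 2 <= x) by (unfold x; lra).
      assert (Hln : / x <= ln x - ln (x - 1)).
      { rewrite <- ln_div by lra.
        eapply Rle_trans; [|apply ln_ge_1_sub_inv, Rdiv_lt_0_compat; lra].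
        right. field. lra. }
      lra. }
  specialize (Hj n (Nat.le_refl n)).
  replace (INR (S n) - INR n) with 1 in Hj by (rewrite S_INR; ring).
  rewrite ln_1 in Hj.
  replace (INR (S (S n)) - INR (S n)) with 1 by (rewrite (S_INR (S n)); ring).
  rewrite Rinv_1. lra.
Qed.

(** In the part m/(b-m) the factor m^(1-s) is raised to b^(1-s), which leaves a harmonic sum. Its
    logarithm is bounded by log y with y common to all rows, so that the rows can be added. *)
Lemma off_diagonal_row_le (s : R) (n : nat) (y : R) :
  1 / 2 <= s < 1 -> INR (S n) <= y ->
  npow s (S n) * sum1 (fun m => npow s m / (ln (INR (S n)) - ln (INR m))) n
  <= npow s (S n) * sum1 (npow s) n + npow (2 * s - 1) (S n) * (1 + ln y).
Proof.
  intros Hs Hy. set (b := INR (S n)) in *.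
  assert (Hb1 : 1 <= b) by (unfold b; rewrite S_INR; pose proof (pos_INR n); lra).
  assert (Hlny : 0 <= ln y).
  { rewrite <- ln_1. apply Rcomplements.ln_le; lra. }
  pose proof (npow_pos (2 * s - 1) (S n)) as Hp2.
  destruct (Nat.eq_dec n 0) as [->|Hn]; [cbn [sum1]; nra|].
  assert (Hq : Rpower b (1 - s) * npow s (S n) = npow (2 * s - 1) (S n)).
  { unfold npow. fold b. rewrite <- Rpower_plus. f_equal. ring. }
  assert (Hrow : sum1 (fun m => npow s m / (ln b - ln (INR m))) n
           <= sum1 (fun m => npow s m + Rpower b (1 - s) * / (b - INR m)) n).
  { apply sum1_le. intros m Hm.
    assert (Hm0 : 0 < INR m) by (apply lt_0_INR; lia).
    assert (Hmb : INR m < b) by (apply lt_INR; lia).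
    set (x := INR m) in *.
    assert (Hl : (b - x) / b <= ln b - ln x).
    { rewrite <- ln_div by lra. eapply Rle_trans; [|apply ln_ge_1_sub_inv, Rdiv_lt_0_compat; lra].
      right. field. lra. }
    assert (Hl0 : 0 < (b - x) / b) by (apply Rdiv_lt_0_compat; lra).
    assert (Hinv : / (ln b - ln x) <= 1 + x * / (b - x)).
    { replace (1 + x * / (b - x)) with (/ ((b - x) / b)) by (field; lra).
      apply Rinv_le_contravar; lra. }
    assert (Hx1 : x * npow s m <= Rpower b (1 - s)).
    { unfold npow. fold x. rewrite <- Rpower_succ by lra.
      replace (1 + - s) with (1 - s) by ring. apply Rle_Rpower_l; lra. }
    pose proof (npow_pos s m) as Hpm.
    assert (0 < / (b - x)) by (apply Rinv_0_lt_compat; lra).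
    unfold Rdiv.
    apply Rle_trans with (npow s m * (1 + x * / (b - x))); [apply Rmult_le_compat_l; lra|].
    assert (x * npow s m * / (b - x) <= Rpower b (1 - s) * / (b - x))
      by (apply Rmult_le_compat_r; lra).
    lra. }
  rewrite sum1_plus, sum1_scal in Hrow.
  pose proof (sum_inv_distance_le n ltac:(lia)) as Hh. fold b in Hh.
  assert (Hlnn : ln (INR n) <= ln y).
  { apply Rcomplements.ln_le; [apply lt_0_INR; lia|].
    unfold b in Hy. rewrite S_INR in Hy. lra. }
  pose proof (npow_pos s (S n)) as Hp.
  eapply Rle_trans; [apply Rmult_le_compat_l; [lra|exact Hrow]|].
  set (h := sum1 (fun m => / (b - INR m)) n) in *.
  rewrite <- Hq in *.
  assert (Rpower b (1 - s) * npow s (S n) * h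
          <= Rpower b (1 - s) * npow s (S n) * (1 + ln y)) by (apply Rmult_le_compat_l; lra).
  lra.
Qed.

(** By symmetry, the sum of (mk)^-s over m < k is half of the full square minus the diagonal. The
    negative diagonal is kept: it is the origin of the -[zeta2]/2 in [eps1]. *)
Lemma off_diagonal_sum_le (s : R) (n : nat) (y : R) :
  1 / 2 <= s < 1 -> INR n <= y ->
  sum1 (fun k => npow s k * sum1 (fun m => npow s m / (ln (INR k) - ln (INR m))) (pred k)) n
  <= (sum1 (npow s) n ^ 2 - sum1 (npow (2 * s)) n) / 2
     + (1 + ln y) * sum1 (npow (2 * s - 1)) n.
Proof.
  intros Hs. induction n as [|n IH]; intros Hy.
  - cbn [sum1]. lra.
  - specialize (IH ltac:(rewrite S_INR in Hy; lra)).
    pose proof (off_diagonal_row_le s n y Hs Hy) as Hrow.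
    cbn [sum1 pred]. pose proof (npow_sqr s (S n)). nra.
Qed.

(** * The value zeta(2 sigma) *)

Lemma sum_npow_tail_le (u : R) (n k : nat) :
  1 < u -> (1 <= n)%nat ->
  sum1 (npow u) (n + k) - sum1 (npow u) n
  <= (Rpower (INR n) (1 - u) - Rpower (INR (n + k)) (1 - u)) / (u - 1).
Proof.
  intros Hu Hn. induction k as [|k IH].
  - rewrite Nat.add_0_r, !Rminus_diag. unfold Rdiv. lra.
  - rewrite Nat.add_succ_r. cbn [sum1]. set (m := (n + k)%nat) in *.
    assert (0 < INR m) by (apply lt_0_INR; lia).
    pose proof (Rpower_increment_ge (INR m) (INR (S m)) u) as Hi.
    specialize (Hi ltac:(rewrite S_INR; lra) ltac:(lra) ltac:(lra)).
    replace (INR (S m) - INR m) with 1 in Hi by (rewrite S_INR; ring).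
    rewrite Rmult_1_l in Hi. unfold npow at 2.
    replace ((Rpower (INR (S m)) (1 - u) - Rpower (INR m) (1 - u)) / (1 - u))
      with ((Rpower (INR m) (1 - u) - Rpower (INR (S m)) (1 - u)) / (u - 1)) in Hi
      by (field; lra).
    unfold Rdiv in *. lra.
Qed.

Lemma dsum_real (u : R) (n : nat) : dsum u 0 n = RtoC (sum1 (npow u) n).
Proof.
  induction n as [|n IH]; [reflexivity|]. cbn [dsum sum1]. rewrite IH, RtoC_plus. f_equal.
  unfold cpow, osc, npow. rewrite Rmult_0_l, cos_0, sin_0.
  apply injective_projections; simpl; ring.
Qed.

Lemma sum1_npow_mono (u : R) (n k : nat) : sum1 (npow u) n <= sum1 (npow u) (n + k).
Proof.
  induction k as [|k IH]; [rewrite Nat.add_0_r; lra|].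
  rewrite Nat.add_succ_r. cbn [sum1]. pose proof (npow_pos u (S (n + k))). lra.
Qed.

(** [is_zeta] describes zeta(u) by the eta series even for u > 1, so the convergent Dirichlet series
    has to be matched with it: if D(n) tends to l, then D(2m) - q D(m) tends to (1-q) l. *)
Lemma zeta_real_is_limit (u z : R) :
  1 < u -> is_zeta u 0 z 0 -> is_lim_seq (fun n => sum1 (npow u) (S n)) z.
Proof.
  intros Hu Hz.
  assert (Hlim : ex_finite_lim_seq (fun n => sum1 (npow u) (S n))).
  { apply (ex_finite_lim_seq_incr _ (1 + 1 / (u - 1))).
    - intros n. cbn [sum1]. pose proof (npow_pos u (S (S n))). lra.
    - intros n. pose proof (sum_npow_tail_le u 1 n Hu (Nat.le_refl 1)) as Ht.
      assert (H1 : forall x, Rpower (INR 1) x = 1).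
      { intros x. simpl INR. unfold Rpower. rewrite ln_1, Rmult_0_r. apply exp_0. }
      rewrite H1 in Ht. cbn [sum1] in Ht. unfold npow at 2 in Ht. rewrite H1 in Ht.
      change (sum1 (npow u) (S n)) with (sum1 (npow u) (1 + n)).
      pose proof (Rpower_pos (INR (1 + n)) (1 - u)).
      assert ((1 - Rpower (INR (1 + n)) (1 - u)) / (u - 1) <= 1 / (u - 1)).
      { apply Rmult_le_compat_r; [left; apply Rinv_0_lt_compat; lra|lra]. }
      lra. }
  destruct Hlim as [l Hl].
  assert (E : @eq C (z, 0) (RtoC l)).
  { apply (is_zeta_eq u 0); [lra|exact Hz|].
    set (q := (RtoC 2 * cpow u 0 2)%C).
    assert (Hsub : filterlim (fun m => S (2 * m)) eventually eventually).
    { intros P [N HN]. exists N. intros n Hn. apply HN. lia. }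
    pose proof (is_lim_seq_subseq _ _ _ Hsub Hl) as Hl2. cbv beta in Hl2.
    apply (is_lim_seq_le_le (fun _ => 0) _
      (fun m => Rabs (l - sum1 (npow u) (S (S (2 * m))))
                + Cmod q * Rabs (l - sum1 (npow u) (S m)))).
    - intros m. split; [apply Cmod_ge_0|]. rewrite !dsum_real.
      replace (S (S (2 * m))) with (2 * S m)%nat by lia.
      rewrite <- !Cmod_R, <- Cmod_mult.
      set (x := sum1 (npow u) (2 * S m)). set (y := sum1 (npow u) (S m)).
      replace (x - q * y - (1 - q) * l)%C with (- RtoC (l - x) + q * RtoC (l - y))%C
        by (rewrite !RtoC_minus; ring).
      eapply Rle_trans; [apply Cmod_triangle|]. rewrite Cmod_opp. lra.
    - apply is_lim_seq_const.
    - replace 0 with (0 + Cmod q * 0) by ring.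
      apply is_lim_seq_plus'; [apply (is_lim_seq_dist _ _ Hl2)|].
      apply (is_lim_seq_scal_l (fun m => Rabs (l - sum1 (npow u) (S m))) (Cmod q) 0).
      apply (is_lim_seq_dist _ _ Hl). }
  apply (f_equal fst) in E. simpl in E. rewrite E. exact Hl.
Qed.

Lemma sum_npow_le_zeta (u z : R) (n : nat) :
  1 < u -> is_zeta u 0 z 0 -> sum1 (npow u) n <= z.
Proof.
  intros Hu Hz. pose proof (zeta_real_is_limit u z Hu Hz) as Hl.
  refine (is_lim_seq_le_loc (fun _ => sum1 (npow u) n) _ _ _ _ (is_lim_seq_const _) Hl).
  exists n. intros m Hm. replace (S m) with (n + (S m - n))%nat by lia. apply sum1_npow_mono.
Qed.

(** The term n+1 is split off so that the integral comparison starts at n+1 >= y; both pieces are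
    then bounded by their values at y. *)
Lemma zeta_tail_le (u z y : R) (n : nat) :
  1 < u -> is_zeta u 0 z 0 -> 0 < y <= INR (S n) ->
  z - sum1 (npow u) n <= Rpower y (1 - u) / (u - 1) + Rpower y (- u).
Proof.
  intros Hu Hz Hy. pose proof (zeta_real_is_limit u z Hu Hz) as Hl.
  assert (Hle : z <= sum1 (npow u) n + Rpower y (1 - u) / (u - 1) + Rpower y (- u)); [|lra].
  refine (is_lim_seq_le_loc _ (fun _ => _) _ _ _ Hl (is_lim_seq_const _)).
  exists n. intros m Hm. replace (S m) with (S n + (m - n))%nat by lia.
  pose proof (sum_npow_tail_le u (S n) (m - n) Hu ltac:(lia)) as Ht.
  change (sum1 (npow u) (S n)) with (sum1 (npow u) n + npow u (S n)) in Ht.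
  assert (H1 : Rpower (INR (S n)) (- (u - 1)) <= Rpower y (- (u - 1)))
    by (apply Rpower_neg_le; lra).
  assert (H2 : npow u (S n) <= Rpower y (- u)) by (apply Rpower_neg_le; lra).
  replace (- (u - 1)) with (1 - u) in H1 by ring.
  pose proof (Rpower_pos (INR (S n + (m - n))) (1 - u)).
  assert ((Rpower (INR (S n)) (1 - u) - Rpower (INR (S n + (m - n))) (1 - u)) / (u - 1)
          <= Rpower y (1 - u) / (u - 1)).
  { apply Rmult_le_compat_r; [left; apply Rinv_0_lt_compat; lra|lra]. }
  lra.
Qed.

(** * The error terms *)

(* [eps1 z s H] is [4 * H0 / (H0 - H) * offd z s H0]. *)
Definition offd (z s T : R) : R :=
  ln T * Rpower T (1 - 2 * s) / (2 * (1 - s))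
  - (2 * s - 1) * ln T / (2 * (1 - s) * T)
  + Rmax 0 ((1 - 3 * s + 3 * s ^ 2) / (2 * (1 - s) ^ 2) - z / 2) / T
  + (2 - s) * Rpower T (1 - 2 * s) / (2 * (1 - s) ^ 2)
  - s * Rpower T (- s) / (1 - s) ^ 2
  + Rpower T (- 2 * s) / (2 * (2 * s - 1))
  + Rpower T (- 2 * s - 1) / 2.

(** With A = T^(1-s), the bounds for [X] and [Y] are polynomials in A and expand into the terms of
    [offd]. Minus half the diagonal is -z/2 plus half a tail of zeta, and this tail gives the last
    two terms. The maximum with 0 makes the constant term, divided by T, decrease in T. *)
Lemma off_diagonal_sum_le_offd (s z T : R) (n : nat) :
  1 / 2 < s < 1 -> is_zeta (2 * s) 0 z 0 -> 1 <= T -> INR n <= T < INR n + 1 ->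
  sum1 (fun k => npow s k * sum1 (fun m => npow s m / (ln (INR k) - ln (INR m))) (pred k)) n
  <= T * offd z s T.
Proof.
  intros Hs Hz HT Hn.
  assert (Hn1 : (1 <= n)%nat).
  { destruct n; [simpl in Hn; lra|lia]. }
  assert (Hn0 : 1 <= INR n) by (apply (le_INR 1); exact Hn1).
  pose proof (off_diagonal_sum_le s n T ltac:(lra) ltac:(lra)) as Hoff.
  pose proof (zeta_tail_le (2 * s) z T n ltac:(lra) Hz ltac:(rewrite S_INR; lra)) as Htail.
  pose proof (sum_npow_le s n ltac:(lra) Hn1) as HX.
  pose proof (sum_npow_le (2 * s - 1) n ltac:(lra) Hn1) as HY.
  assert (HX0 : 0 <= sum1 (npow s) n) by (apply sum1_ge_0; intros; left; apply npow_pos).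
  set (X := sum1 (npow s) n) in *. set (Y := sum1 (npow (2 * s - 1)) n) in *.
  set (A := Rpower T (1 - s)).
  assert (HA : Rpower (INR n) (1 - s) <= A) by (apply Rle_Rpower_l; lra).
  assert (HA2 : Rpower (INR n) (1 - (2 * s - 1)) <= A ^ 2).
  { replace (A ^ 2) with (Rpower T (1 - (2 * s - 1))).
    - apply Rle_Rpower_l; lra.
    - unfold A. simpl. rewrite Rmult_1_r, <- Rpower_plus. f_equal. ring. }
  assert (HA1 : 1 <= A).
  { replace 1 with (Rpower T 0) by (apply Rpower_O; lra). apply Rle_Rpower; lra. }
  assert (HX2 : X ^ 2 <= ((A - s) / (1 - s)) ^ 2).
  { apply pow_incr. split; [exact HX0|]. eapply Rle_trans; [exact HX|].
    apply Rmult_le_compat_r; [left; apply Rinv_0_lt_compat; lra|lra]. }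
  assert (HY2 : Y <= (A ^ 2 - (2 * s - 1)) / (2 * (1 - s))).
  { eapply Rle_trans; [exact HY|]. replace (1 - (2 * s - 1)) with (2 * (1 - s)) in * by ring.
    apply Rmult_le_compat_r; [left; apply Rinv_0_lt_compat; lra|lra]. }
  assert (Hln : 0 <= ln T) by (rewrite <- ln_1; apply Rcomplements.ln_le; lra).
  assert (HlnY : (1 + ln T) * Y <= (1 + ln T) * ((A ^ 2 - (2 * s - 1)) / (2 * (1 - s))))
    by (apply Rmult_le_compat_l; lra).
  set (E := Rpower T (1 - 2 * s)) in *.
  assert (HTE : T * E = A ^ 2).
  { unfold E, A. rewrite <- Rpower_succ by lra. simpl.
    rewrite Rmult_1_r, <- Rpower_plus. f_equal. ring. }
  assert (HTs : T * Rpower T (- s) = A).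
  { unfold A. rewrite <- Rpower_succ by lra. f_equal. }
  assert (HTF : T * Rpower T (- 2 * s) = E).
  { unfold E. rewrite <- Rpower_succ by lra. f_equal. ring. }
  assert (HTG : T * Rpower T (- 2 * s - 1) = Rpower T (- (2 * s))).
  { rewrite <- Rpower_succ by lra. f_equal. ring. }
  pose proof (Rmax_r 0 ((1 - 3 * s + 3 * s ^ 2) / (2 * (1 - s) ^ 2) - z / 2)) as Hmax.
  set (M := Rmax _ _) in *.
  replace (T * offd z s T) with
    (ln T * (T * E) / (2 * (1 - s)) - (2 * s - 1) * ln T / (2 * (1 - s)) + M
     + (2 - s) * (T * E) / (2 * (1 - s) ^ 2) - s * (T * Rpower T (- s)) / (1 - s) ^ 2
     + (T * Rpower T (- 2 * s)) / (2 * (2 * s - 1)) + (T * Rpower T (- 2 * s - 1)) / 2)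
    by (unfold offd; fold E M; field; lra).
  rewrite HTE, HTs, HTF, HTG.
  set (F := Rpower T (- (2 * s))) in *.
  assert (Heq : ((A - s) / (1 - s)) ^ 2 / 2 + (1 + ln T) * ((A ^ 2 - (2 * s - 1)) / (2 * (1 - s)))
    = ln T * A ^ 2 / (2 * (1 - s)) - (2 * s - 1) * ln T / (2 * (1 - s))
      + (1 - 3 * s + 3 * s ^ 2) / (2 * (1 - s) ^ 2)
      + (2 - s) * A ^ 2 / (2 * (1 - s) ^ 2) - s * A / (1 - s) ^ 2) by (field; lra).
  replace (E / (2 * (2 * s - 1))) with (E / (2 * s - 1) / 2) by (field; lra).
  lra.
Qed.

(** * Monotonicity and sign of the off-diagonal bracket *)

Lemma exp_24_le : exp 24 <= H0.
Proof.
  assert (Hsq : forall x m, exp x <= m -> exp (2 * x) <= m * m).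
  { intros x m Hm. replace (2 * x) with (x + x) by ring. rewrite exp_plus.
    pose proof (exp_pos x). apply Rmult_le_compat; lra. }
  (* From e^(-x) >= 1 - x at x = 1/128. Seven squarings reach e, a cube e^3, and three more
     squarings e^24; rounding up at each stage stays below [H0]. *)
  assert (E0 : exp (/ 128) <= 1.007875).
  { pose proof (exp_ineq1_le (- / 128)) as He. rewrite exp_Ropp in He.
    pose proof (exp_pos (/ 128)) as Hp.
    apply Rmult_le_reg_l with (/ exp (/ 128)); [apply Rinv_0_lt_compat; lra|].
    rewrite Rinv_l by lra. lra. }
  apply Hsq in E0. apply Rle_trans with (r3 := 1.015813) in E0; [|lra].
  apply Hsq in E0. apply Rle_trans with (r3 := 1.031877) in E0; [|lra].
  apply Hsq in E0. apply Rle_trans with (r3 := 1.064771) in E0; [|lra].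
  apply Hsq in E0. apply Rle_trans with (r3 := 1.133738) in E0; [|lra].
  apply Hsq in E0. apply Rle_trans with (r3 := 1.285362) in E0; [|lra].
  apply Hsq in E0. apply Rle_trans with (r3 := 1.652156) in E0; [|lra].
  apply Hsq in E0. apply Rle_trans with (r3 := 2.72962) in E0; [|lra].
  assert (E3 : exp 3 <= 20.3385).
  { pose proof (Hsq _ _ E0) as E2.
    replace 3 with (2 * (2 * (2 * (2 * (2 * (2 * (2 * (2 * / 128)))))))
                    + 2 * (2 * (2 * (2 * (2 * (2 * (2 * / 128))))))) by field.
    rewrite exp_plus. apply Rle_trans with (2.72962 * 2.72962 * 2.72962); [|lra].
    apply Rmult_le_compat; [left; apply exp_pos|left; apply exp_pos|exact E2|exact E0]. }
  apply Hsq in E3. apply Rle_trans with (r3 := 413.66) in E3; [|lra].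
  apply Hsq in E3. apply Rle_trans with (r3 := 171115) in E3; [|lra].
  apply Hsq in E3.
  replace 24 with (2 * (2 * (2 * 3))) by ring. unfold H0. lra.
Qed.

Lemma ln_H0_ge : 24 <= ln H0.
Proof.
  rewrite <- (ln_exp 24). apply Rcomplements.ln_le; [apply exp_pos | apply exp_24_le].
Qed.

(** Up to the factor e^-L/(2b^2), this is the derivative in L = log T of [offd] without the [Rmax]
    term and the last two, with b = 1-s and y = T^b. It is at most -y (k y - (3 - 6b + 2b^2)), and
    [k0], [y0] bound k, y from below by their values at L = 24, y through its quadratic Taylor
    bound. The upper end of b keeps [k0] positive; near the lower end [Hpoly] has little room. *)
Lemma main_slope_le_0 (b L y : R) :
  277 / 10000 <= b <= 4792 / 10000 -> 24 <= L -> 1 + b * L + (b * L) ^ 2 / 2 <= y ->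
  - ((1 - 2 * b) * b * L) * (y ^ 2 - 1) - y ^ 2 * (1 - 2 * b - 2 * b ^ 2)
  + 2 * (1 - b) ^ 2 * y - (1 - 2 * b) * b <= 0.
Proof.
  intros Hb HL Hy.
  set (k := (1 - 2 * b) * b * L + (1 - 2 * b - 2 * b ^ 2)).
  set (k0 := 1 + 22 * b - 50 * b ^ 2). set (y0 := 1 + 24 * b + 288 * b ^ 2).
  assert (Hk : k0 <= k).
  { unfold k, k0. assert (0 <= (1 - 2 * b) * b * (L - 24)); [|nra].
    apply Rmult_le_pos; nra. }
  assert (Hk0 : 0 < k0) by (unfold k0; nra).
  assert (HbL : 24 * b <= b * L) by nra.
  assert (Hy0 : y0 <= y) by (unfold y0; nra).
  assert (Hy00 : 0 < y0) by (unfold y0; nra).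
  assert (Hpoly : 3 - 6 * b + 2 * b ^ 2 <= k0 * y0).
  { assert (0 <= - 2 + 52 * b + b ^ 2 * (764 + b * (5136 - 14400 * b))); [|unfold k0, y0; nra].
    (* The factor 5136 - 14400 b is positive up to 0.3; beyond, the linear term 52 b outweighs the
       negative part. *)
    destruct (Rle_dec b (3 / 10)) as [H3|H3].
    - assert (0 <= b * (5136 - 14400 * b)) by nra.
      assert (b ^ 2 * 764 <= b ^ 2 * (764 + b * (5136 - 14400 * b)))
        by (apply Rmult_le_compat_l; nra).
      assert (0 <= b ^ 3) by (apply pow_le; lra).
      nra.
    - assert (- 850 <= b * (5136 - 14400 * b)) by nra.
      assert (b ^ 2 * (- 86) <= b ^ 2 * (764 + b * (5136 - 14400 * b)))
        by (apply Rmult_le_compat_l; nra).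
      nra. }
  assert (Hky : k0 * y0 <= k * y) by (apply Rmult_le_compat; lra).
  assert (Hrest : (1 - 2 * b) * b * (L - 1) <= (1 - 2 * b) * y).
  { rewrite Rmult_assoc. apply Rmult_le_compat_l; [lra|].
    assert (0 <= (b * L) ^ 2) by apply pow2_ge_0. lra. }
  assert (0 <= y * (k * y - (3 - 6 * b + 2 * b ^ 2))) by (apply Rmult_le_pos; lra).
  unfold k in *. nra.
Qed.

(** In the variable log x every power becomes an exponential, so the derivative factors through the
    polynomial of [main_slope_le_0]. The terms left out of [f] decrease individually. *)
Lemma offd_decreasing (z s S T : R) :
  5208 / 10000 < s < 9723 / 10000 -> 24 <= ln S -> 0 < S <= T -> offd z s T <= offd z s S.
Proof.
  intros Hs HS HST. set (b := 1 - s).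
  set (f := fun L => - (L * exp ((1 - 2 * s) * L) / (2 * b) - (2 * s - 1) * L * exp (- L) / (2 * b)
              + (2 - s) * exp ((1 - 2 * s) * L) / (2 * b ^ 2) - s * exp (- s * L) / b ^ 2)).
  assert (HlnST : ln S <= ln T) by (apply Rcomplements.ln_le; lra).
  assert (Hf : f (ln S) <= f (ln T)).
  { apply (nondecreasing_of_derive f (fun L => - (exp (- L) / (2 * b ^ 2) *
      (- ((1 - 2 * b) * b * L) * (exp (b * L) ^ 2 - 1)
       - exp (b * L) ^ 2 * (1 - 2 * b - 2 * b ^ 2)
       + 2 * (1 - b) ^ 2 * exp (b * L) - (1 - 2 * b) * b)))); [exact HlnST| |].
    - intros L _. unfold f. auto_derive; [unfold b; lra|].
      replace (exp ((1 - 2 * s) * L)) with (exp (- L) * exp (b * L) ^ 2).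
      2: { simpl. rewrite Rmult_1_r, <- !exp_plus. f_equal. unfold b. ring. }
      replace (exp (- s * L)) with (exp (- L) * exp (b * L)).
      2: { rewrite <- exp_plus. f_equal. unfold b. ring. }
      unfold b. field. lra.
    - intros L HL.
      assert (Hexp : 1 + b * L + (b * L) ^ 2 / 2 <= exp (b * L)).
      { pose proof (exp_ge_taylor (b * L) 2) as Ht. simpl in Ht.
        assert (0 <= b * L) by (unfold b; nra). specialize (Ht ltac:(lra)). lra. }
      pose proof (main_slope_le_0 b L (exp (b * L)) ltac:(unfold b; lra) ltac:(lra) Hexp) as Hsl.
      assert (0 < exp (- L) / (2 * b ^ 2)).
      { apply Rdiv_lt_0_compat; [apply exp_pos|]. unfold b. nra. }
      nra. }
  assert (Hexpr : forall x, 0 < x -> offd z s x =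
      - f (ln x) + Rmax 0 ((1 - 3 * s + 3 * s ^ 2) / (2 * (1 - s) ^ 2) - z / 2) / x
      + Rpower x (- (2 * s)) / (2 * (2 * s - 1)) + Rpower x (- (2 * s + 1)) / 2).
  { intros x Hx. unfold offd, f. rewrite exp_Ropp, exp_ln by exact Hx.
    replace (- 2 * s - 1) with (- (2 * s + 1)) by ring.
    replace (- 2 * s) with (- (2 * s)) by ring.
    fold (Rpower x (1 - 2 * s)). fold (Rpower x (- s)).
    unfold b. field. lra. }
  rewrite !Hexpr by lra.
  pose proof (Rmax_l 0 ((1 - 3 * s + 3 * s ^ 2) / (2 * (1 - s) ^ 2) - z / 2)) as HM.
  set (M := Rmax _ _) in *.
  assert (M / T <= M / S) by (apply Rmult_le_compat_l; [lra|apply Rinv_le_contravar; lra]).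
  assert (Rpower T (- (2 * s)) / (2 * (2 * s - 1)) <= Rpower S (- (2 * s)) / (2 * (2 * s - 1))).
  { apply Rmult_le_compat_r; [left; apply Rinv_0_lt_compat; lra|apply Rpower_neg_le; lra]. }
  pose proof (Rpower_neg_le S T (2 * s + 1) ltac:(lra) ltac:(lra)).
  lra.
Qed.

(** The bracket has terms of both signs; its sign follows from dominating a sum of nonnegative
    terms. *)
Lemma offd_ge_0 (s z T : R) :
  1 / 2 < s < 1 -> is_zeta (2 * s) 0 z 0 -> 1 <= T -> 0 <= T * offd z s T.
Proof.
  intros Hs Hz HT. destruct (nfloor_ex T ltac:(lra)) as [n Hn].
  eapply Rle_trans; [|apply (off_diagonal_sum_le_offd s z T n Hs Hz HT Hn)].
  apply sum1_ge_0. intros k Hk. apply Rmult_le_pos; [left; apply npow_pos|].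
  apply sum1_ge_0. intros m Hm. apply Rdiv_le_0_compat; [left; apply npow_pos|].
  assert (0 < INR m) by (apply lt_0_INR; lia).
  assert (INR m < INR k) by (apply lt_INR; lia).
  pose proof (ln_increasing (INR m) (INR k)). lra.
Qed.

(** * Mean squares of the partial sum and of the remainder *)

(** T is traded for [H0] in both factors: T/(T-H) <= H0/(H0-H), and the bracket decreases.
    Multiplying these bounds uses that the bracket is nonnegative. *)
Lemma partial_sum_mean_square_le (s H T z : R) (n : nat) :
  5208 / 10000 < s < 9723 / 10000 -> 1000 <= H < H0 -> H0 <= T ->
  is_zeta (2 * s) 0 z 0 -> INR n <= T < INR n + 1 ->
  exists v, is_RInt (fun t => Cmod (tsum s n t) ^ 2) H T v
            /\ v <= (T - H) * (z + eps1 z s H).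
Proof.
  intros Hs HH HT Hz Hn.
  destruct (tsum_mean_square s H T n ltac:(lra) ltac:(lra)) as [v [Hv Hle]].
  exists v. split; [exact Hv|].
  assert (H01 : 1 <= H0) by (unfold H0; lra).
  pose proof (off_diagonal_sum_le_offd s z T n ltac:(lra) Hz ltac:(lra) Hn) as Hoff.
  pose proof (sum_npow_le_zeta (2 * s) z n ltac:(lra) Hz) as Hdiag.
  pose proof (offd_decreasing z s H0 T Hs ln_H0_ge ltac:(lra)) as Hdec.
  pose proof (offd_ge_0 s z T ltac:(lra) Hz ltac:(lra)) as HT0.
  change (eps1 z s H) with (4 * H0 / (H0 - H) * offd z s H0).
  set (o := offd z s T) in *. set (o0 := offd z s H0) in *.
  assert (Ho : 0 <= o) by nra.
  assert (HTo : T * o <= (T - H) * (H0 / (H0 - H) * o0)).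
  { replace ((T - H) * (H0 / (H0 - H) * o0)) with (((T - H) * H0 / (H0 - H)) * o0)
      by (field; lra).
    apply Rmult_le_compat; [lra|exact Ho| |exact Hdec].
    apply (Rle_div_r T); nra. }
  assert (Hd : (T - H) * sum1 (npow (2 * s)) n <= (T - H) * z) by (apply Rmult_le_compat_l; lra).
  replace (4 * H0 / (H0 - H) * o0) with (4 * (H0 / (H0 - H) * o0)) by (field; lra).
  lra.
Qed.

(** By convexity of t^-a, a = 2s-1, the mean descent over [H, T] is at most that over [H, H0]. The
    tangent slope at [H0], up to sign [m], separates the descents before and after [H0]. *)
Lemma remainder_mean_square_le (s H T : R) :
  1 / 2 < s -> 0 < H < H0 -> H0 <= T ->
  exists w, is_RInt (fun t => c0 ^ 2 * Rpower t (- (2 * s))) H T w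
            /\ w <= (T - H) * eps2 s H.
Proof.
  intros Hs HH HT. set (a := 2 * s - 1).
  set (F := fun t => - (c0 ^ 2 / a * Rpower t (- a))).
  exists (F T - F H). split.
  - apply (is_RInt_derive F).
    + intros t Ht. rewrite Rmin_left in Ht by lra.
      unfold F. unfold Rpower at 1. auto_derive; [lra|].
      fold (Rpower t (- a)). replace (- (2 * s)) with (- a - 1) by (unfold a; ring).
      replace (Rpower t (- a)) with (t * Rpower t (- a - 1)).
      * field. unfold a. lra.
      * rewrite <- Rpower_succ by lra. f_equal. ring.
    + intros t Ht. rewrite Rmin_left in Ht by lra.
      apply (ex_derive_continuous (fun t => c0 ^ 2 * Rpower t (- (2 * s)))).
      unfold Rpower. auto_derive. lra.
  - pose proof (Rpower_chord H H0 a ltac:(lra) ltac:(lra) ltac:(unfold a; lra)) as C1.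
    pose proof (Rpower_chord T H0 a ltac:(lra) ltac:(lra) ltac:(unfold a; lra)) as C2.
    unfold F, eps2. fold a.
    set (h := Rpower H (- a)) in *. set (h0 := Rpower H0 (- a)) in *.
    set (k := Rpower T (- a)) in *. set (m := h0 * a / H0).
    assert (D1 : m * (H0 - H) <= h - h0).
    { replace (m * (H0 - H)) with (h0 * (1 + a * (1 - H / H0)) - h0) by (unfold m; field; lra).
      lra. }
    assert (D2 : h0 - k <= m * (T - H0)).
    { replace (m * (T - H0)) with (h0 - h0 * (1 + a * (1 - T / H0))) by (unfold m; field; lra).
      lra. }
    assert (D3 : h - k <= (T - H) * ((h - h0) / (H0 - H))).
    { replace ((T - H) * ((h - h0) / (H0 - H))) with ((T - H) * (h - h0) / (H0 - H))
        by (field; lra).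
      apply (Rle_div_r (h - k)); [lra|].
      assert (D4 : (h0 - k) * (H0 - H) <= m * (T - H0) * (H0 - H))
        by (apply Rmult_le_compat_r; lra).
      assert (D5 : m * (H0 - H) * (T - H0) <= (h - h0) * (T - H0))
        by (apply Rmult_le_compat_r; lra).
      nra. }
    assert (Hc : 0 <= c0 ^ 2 / a).
    { apply Rdiv_le_0_compat; [apply pow2_ge_0|unfold a; lra]. }
    apply (Rmult_le_compat_l _ _ _ Hc) in D3. lra.
Qed.

(** Strictness makes the optimal Young parameter, proportional to the root of [eps2], invertible. *)
Lemma eps2_pos (s H : R) : 1 / 2 < s -> 0 < H < H0 -> 0 < eps2 s H.
Proof.
  intros Hs HH. unfold eps2. apply Rmult_lt_0_compat.
  - apply Rdiv_lt_0_compat; [unfold c0; lra|lra].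
  - apply Rdiv_lt_0_compat; [|lra].
    rewrite !Rpower_Ropp.
    assert (/ Rpower H0 (2 * s - 1) < / Rpower H (2 * s - 1)); [|lra].
    apply Rinv_lt_contravar; [apply Rmult_lt_0_compat; apply Rpower_pos|].
    apply Rlt_Rpower_l; lra.
Qed.

Lemma eps1_ge_0 (s H z : R) :
  1 / 2 < s < 1 -> H < H0 -> is_zeta (2 * s) 0 z 0 -> 0 <= eps1 z s H.
Proof.
  intros Hs HH Hz.
  pose proof (offd_ge_0 s z H0 Hs Hz ltac:(unfold H0; lra)) as Ho.
  change (eps1 z s H) with (4 * H0 / (H0 - H) * offd z s H0).
  replace (4 * H0 / (H0 - H) * offd z s H0) with (4 * (H0 * offd z s H0) / (H0 - H))
    by (field; lra).
  apply Rdiv_le_0_compat; lra.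
Qed.

Lemma zeta_gt_1_pos (u z : R) : 1 < u -> is_zeta u 0 z 0 -> 0 < z.
Proof.
  intros Hu Hz. pose proof (sum_npow_le_zeta u z 1 Hu Hz) as H1. cbn [sum1] in H1.
  pose proof (npow_pos u 1). lra.
Qed.

Lemma calE1_total_pos (s H z : R) :
  1 / 2 < s < 1 -> 0 < H < H0 -> is_zeta (2 * s) 0 z 0 -> 0 < z + calE1 z s H.
Proof.
  intros Hs HH Hz. unfold calE1, eps3.
  pose proof (zeta_gt_1_pos (2 * s) z ltac:(lra) Hz).
  pose proof (eps1_ge_0 s H z Hs ltac:(lra) Hz).
  pose proof (eps2_pos s H ltac:(lra) HH).
  pose proof (sqrt_pos (eps2 s H * (z + eps1 z s H))). lra.
Qed.

(* Young's inequality |A + R|^2 <= (1 + l) |A|^2 + (1 + 1/l) |R|^2 replaces the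
   Cauchy-Schwarz inequality: with l = sqrt (e / a) both give (sqrt a + sqrt e)^2. *)
Lemma zeta_square_majorant (s H T z : R) (zr zi : R -> R) :
  5208 / 10000 < s < 9723 / 10000 -> 1000 <= H < H0 -> H0 <= T ->
  (forall t, is_zeta s t (zr t) (zi t)) -> is_zeta (2 * s) 0 z 0 ->
  exists (B : R -> R) (I : R),
    (forall t, H <= t <= T -> zr t ^ 2 + zi t ^ 2 <= B t) /\
    is_RInt B H T I /\ I <= (T - H) * (z + calE1 z s H).
Proof.
  intros Hs HH HT Hzeta Hz.
  destruct (nfloor_ex T ltac:(lra)) as [n Hn].
  destruct (partial_sum_mean_square_le s H T z n Hs HH HT Hz Hn) as [v [Hv Hvle]].
  destruct (remainder_mean_square_le s H T ltac:(lra) ltac:(lra) HT) as [w [Hw Hwle]].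
  pose proof (zeta_gt_1_pos (2 * s) z ltac:(lra) Hz) as Hz0.
  pose proof (eps1_ge_0 s H z ltac:(lra) ltac:(lra) Hz) as He1.
  pose proof (eps2_pos s H ltac:(lra) ltac:(lra)) as He2.
  unfold calE1, eps3. set (e := eps2 s H) in *. set (a := z + eps1 z s H) in *.
  assert (Ha : 0 < a) by (unfold a; lra).
  pose proof (sqrt_lt_R0 a Ha) as Hsa. pose proof (sqrt_lt_R0 e He2) as Hse.
  set (l := sqrt e / sqrt a).
  assert (Hl : 0 < l) by (apply Rdiv_lt_0_compat; lra).
  assert (Hl' : 0 < / l) by (apply Rinv_0_lt_compat; lra).
  exists (fun t => (1 + l) * Cmod (tsum s n t) ^ 2 + (1 + / l) * (c0 ^ 2 * Rpower t (- (2 * s)))),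
    ((1 + l) * v + (1 + / l) * w).
  split; [|split].
  - intros t Ht. destruct (nfloor_ex t ltac:(lra)) as [k Hk].
    assert (Hkn : (k <= n)%nat).
    { assert (Hlt : INR k < INR (S n)) by (rewrite S_INR; lra).
      apply INR_lt in Hlt. lia. }
    replace n with (k + (n - k))%nat by lia. rewrite (tsum_floor s t k) by exact Hk.
    pose proof (zeta_approx s t (zr t) (zi t) k ltac:(lra) ltac:(lra) Hk (Hzeta t)) as Happ.
    set (A := dsum s t k) in *. set (R0 := ((zr t, zi t) - A)%C) in *.
    pose proof (Cmod_ge_0 A) as HA. pose proof (Cmod_ge_0 R0) as HR.
    assert (Htri : Cmod (zr t, zi t) <= Cmod A + Cmod R0).
    { replace ((zr t, zi t) : C) with (A + R0)%C by (unfold R0; ring). apply Cmod_triangle. }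
    pose proof (Cmod_ge_0 (zr t, zi t)) as HZ.
    pose proof (Cmod_sqr (zr t, zi t)) as HZ2. cbn [fst snd] in HZ2. rewrite <- HZ2.
    replace (c0 ^ 2 * Rpower t (- (2 * s))) with ((c0 * Rpower t (- s)) ^ 2).
    2: { rewrite Rpow_mult_distr. f_equal. simpl. rewrite Rmult_1_r, <- Rpower_plus.
         f_equal. ring. }
    set (x := Cmod A) in *. set (y := Cmod R0) in *. set (q := c0 * Rpower t (- s)) in *.
    assert (Hyq : y ^ 2 <= q ^ 2) by (apply pow_incr; lra).
    assert (Hsum : Cmod (zr t, zi t) ^ 2 <= (x + y) ^ 2) by (apply pow_incr; lra).
    assert (Hyoung : 2 * x * y <= l * x ^ 2 + / l * y ^ 2).
    { assert (0 <= l * (x - / l * y) ^ 2) by (apply Rmult_le_pos; [lra|apply pow2_ge_0]).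
      replace (l * (x - / l * y) ^ 2) with (l * x ^ 2 - 2 * x * y + / l * y ^ 2) in * by (field; lra).
      lra. }
    assert (/ l * y ^ 2 <= / l * q ^ 2) by (apply Rmult_le_compat_l; lra).
    nra.
  - apply (is_RInt_plus (fun t => (1 + l) * Cmod (tsum s n t) ^ 2)).
    + apply (is_RInt_scal (fun t => Cmod (tsum s n t) ^ 2)). exact Hv.
    + apply (is_RInt_scal (fun t => c0 ^ 2 * Rpower t (- (2 * s)))). exact Hw.
  - assert (Hopt : (1 + l) * a + (1 + / l) * e = a + e + 2 * sqrt (e * a)).
    { assert (Hpq : forall p q, 0 < p -> 0 < q ->
        (1 + q / p) * (p * p) + (1 + / (q / p)) * (q * q) = p * p + q * q + 2 * (q * p))
        by (intros; field; lra).
      specialize (Hpq (sqrt a) (sqrt e) Hsa Hse). rewrite !sqrt_sqrt in Hpq by lra.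
      rewrite sqrt_mult by lra. exact Hpq. }
    replace (z + (eps1 z s H + e + 2 * sqrt (e * a))) with (a + e + 2 * sqrt (e * a))
      by (unfold a; ring).
    rewrite <- Hopt.
    assert ((1 + l) * v <= (1 + l) * ((T - H) * a)) by (apply Rmult_le_compat_l; lra).
    assert ((1 + / l) * w <= (1 + / l) * ((T - H) * e)) by (apply Rmult_le_compat_l; lra).
    lra.
Qed.

(** * The truncated logarithm and the final integration *)

(** The tangent of the logarithm at c, applied to the square of the truncated modulus, which is at
    most u + e^(-2M). The bound is linear in u, so u may be replaced by an integrable majorant. *)
Lemma ln_truncated_le (u M c : R) :
  0 <= u -> 0 < c ->
  ln (Rmax (sqrt u) (exp (- M))) <= / (2 * c) * u + ((ln c - 1) / 2 + exp (- (2 * M)) / (2 * c)).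
Proof.
  intros Hu Hc. set (r := Rmax (sqrt u) (exp (- M))).
  assert (Hr : 0 < r) by (eapply Rlt_le_trans; [apply exp_pos | apply Rmax_r]).
  assert (Hr2 : r ^ 2 <= u + exp (- (2 * M))).
  { unfold r. pose proof (exp_pos (- (2 * M))).
    assert (E : exp (- M) ^ 2 = exp (- (2 * M))).
    { simpl. rewrite Rmult_1_r, <- exp_plus. f_equal. ring. }
    apply Rmax_case; [rewrite pow2_sqrt by exact Hu | rewrite E]; lra. }
  assert (Hln : 2 * ln r <= ln c + (r ^ 2 / c - 1)).
  { replace (2 * ln r) with (ln c + ln (r ^ 2 / c)).
    - apply Rplus_le_compat_l, ln_le_sub_1, Rdiv_lt_0_compat; [nra|lra].
    - rewrite ln_div by nra. simpl. rewrite Rmult_1_r, ln_mult by lra. ring. }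
  assert (r ^ 2 / c <= (u + exp (- (2 * M))) / c).
  { apply Rmult_le_compat_r; [left; apply Rinv_0_lt_compat; lra|exact Hr2]. }
  replace (/ (2 * c) * u + ((ln c - 1) / 2 + exp (- (2 * M)) / (2 * c)))
    with ((ln c + ((u + exp (- (2 * M))) / c - 1)) / 2) by (field; lra).
  lra.
Qed.

(* zr t + i zi t = zeta(sigma0 + i t); zeta2 = zeta(2 sigma0).
   The second claim (integral of log|zeta|, a possibly improper/Lebesgue
   integral because of possible zeros) is stated via truncation from below:
   the integrals of max(log|zeta|, -M) decrease to the integral of log|zeta|
   as M -> oo, and we assert their limit is <= the bound. *)
Theorem theorem3 :
  forall (sigma0 H : R) (zr zi : R -> R) (zeta2 : R),
    5208 / 10000 < sigma0 < 9723 / 10000 ->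
    1000 <= H < H0 ->
    (forall t, is_zeta sigma0 t (zr t) (zi t)) ->
    is_zeta (2 * sigma0) 0 zeta2 0 ->
    forall T : R, H0 <= T ->
      (forall pr : Riemann_integrable (fun t => zr t ^ 2 + zi t ^ 2) H T,
          / (T - H) * RiemannInt pr <= zeta2 + calE1 zeta2 sigma0 H) /\
      (forall eps : R, 0 < eps ->
         exists M0 : R, forall M : R, M0 <= M ->
           forall pr : Riemann_integrable
               (fun t => ln (Rmax (sqrt (zr t ^ 2 + zi t ^ 2)) (exp (- M)))) H T,
             RiemannInt pr <= (T - H) / 2 * ln (zeta2 + calE1 zeta2 sigma0 H) + eps).
Proof.
  intros s H zr zi z Hs HH Hzeta Hz T HT.
  destruct (zeta_square_majorant s H T z zr zi Hs HH HT Hzeta Hz) as (B & I & HB & HI & HIle).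
  pose proof (calE1_total_pos s H z ltac:(lra) ltac:(lra) Hz) as Hc.
  set (c := z + calE1 z s H) in *.
  assert (Hint : forall (f : R -> R) (pr : Riemann_integrable f H T),
            is_RInt f H T (RiemannInt pr)).
  { intros f pr. rewrite <- RInt_Reals.
    apply (RInt_correct (V := R_CompleteNormedModule)), ex_RInt_Reals_1, pr. }
  split.
  - intros pr.
    assert (Hle : RiemannInt pr <= I).
    { apply (is_RInt_le (fun t => zr t ^ 2 + zi t ^ 2) B H T); [lra|apply Hint|exact HI|].
      intros t Ht. apply HB. lra. }
    apply Rmult_le_reg_l with (T - H); [lra|].
    rewrite <- Rmult_assoc, Rinv_r, Rmult_1_l by lra. lra.
  (* Chosen so that (T-H) e^(-2M)/(2c), the total cost of truncation, is at most eps. *)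
  - intros eps Heps. exists (- (ln (2 * c * eps / (T - H)) / 2)). intros M HM pr.
    set (d := (ln c - 1) / 2 + exp (- (2 * M)) / (2 * c)).
    assert (Hle : RiemannInt pr <= / (2 * c) * I + (T - H) * d).
    { apply (is_RInt_le (fun t => ln (Rmax (sqrt (zr t ^ 2 + zi t ^ 2)) (exp (- M))))
               (fun t => / (2 * c) * B t + d) H T); [lra|apply Hint| |].
      - apply (is_RInt_plus (fun t => / (2 * c) * B t)).
        + apply (is_RInt_scal B). exact HI.
        + apply (is_RInt_const H T d).
      - intros t Ht. specialize (HB t ltac:(lra)).
        eapply Rle_trans; [apply (ln_truncated_le _ M c); [nra|exact Hc]|].
        fold d. apply Rplus_le_compat_r, Rmult_le_compat_l; [|exact HB].
        left. apply Rinv_0_lt_compat. lra. }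
    assert (Hexp : exp (- (2 * M)) <= 2 * c * eps / (T - H)).
    { assert (Hpos : 0 < 2 * c * eps / (T - H)) by (apply Rdiv_lt_0_compat; nra).
      rewrite <- (exp_ln (2 * c * eps / (T - H))) by exact Hpos.
      destruct (Rle_lt_or_eq_dec (- (2 * M)) (ln (2 * c * eps / (T - H)))) as [Hlt|Heq]; [lra| |].
      - left. apply exp_increasing, Hlt.
      - right. f_equal. exact Heq. }
    (* The majorant has mean at most c, so this term cancels the -1/2 in [d] and leaves (T-H)/2
       times log c. *)
    assert (HI2 : / (2 * c) * I <= (T - H) / 2).
    { replace ((T - H) / 2) with (/ (2 * c) * ((T - H) * c)) by (field; lra).
      apply Rmult_le_compat_l; [left; apply Rinv_0_lt_compat; lra|exact HIle]. }
    assert (He : (T - H) * (exp (- (2 * M)) / (2 * c)) <= eps).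
    { replace eps with ((T - H) * (2 * c * eps / (T - H) / (2 * c))) by (field; lra).
      apply Rmult_le_compat_l; [lra|].
      apply Rmult_le_compat_r; [left; apply Rinv_0_lt_compat; lra|exact Hexp]. }
    unfold d in Hle. lra.
Qed.
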